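(* Let $F:\mathbb R^d\to\mathbb R$ be bounded below by $F_*$, $L$-smooth and twice differentiable, with stochastic gradients satisfying the $p$-bounded central moment condition with constant $\sigma$ and stochastic Hessians satisfying the $p$-bounded central moment condition with constant $\sigma_h$, where $p\in(1,2]$. Let $\Delta_1:=F(x_0)-F_*$, $\delta\in(0,1]$ and $T\ge1$ with $\log(8T/\delta)\ge1$. Suppose the algorithm Clip NSGDHess is executed with momentum parameter $\alpha=T^{-\frac p{2p-1}}$, clipping levels $$\lambda=\max\Big\{4\sqrt{L\Delta_1},\frac{\sigma}{\alpha^{1/p}}\Big\},\qquad \lambda_h=\frac{2\gamma(L+\sigma_h)}{\alpha^{1/p}},$$ and stepsize $\gamma$ equal to $$c\,\min\Big\{\sqrt{\frac{\Delta_1}{LT}},\ \alpha\sqrt{\frac{\Delta_1}{L}},\ \frac{\sqrt{\Delta_1/L}}{\alpha T\log(T/\delta)},\ \frac{\Delta_1}{\sigma\alpha^{\frac{p-1}p}T\log(T/\delta)},\ \sqrt{\frac{\Delta_1\alpha^{1/p}}{(L+\sigma_h)T\log(T/\delta)}}\Big\}$$ for a suitable universal constant $c>0$. Then the algorithm ensures that, with probability at least $1-\delta$, $\frac1T\sum_{t=0}^{T-1}\|\nabla F(x_t)\|\le\varepsilon$, and to achieve this it requires at most $$\mathcal O\Big(\Big(\frac{\sqrt{\Delta_1(L+\sigma_h)}+\sigma}{\varepsilon}\,\log\frac1{\delta\varepsilon}\Big)^{\frac{2p-1}{p-1}}\Big)$$ first/second-order oracle calls.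
   Context: **Problem.** Minimize $F(x)=\mathbb E_{\xi\sim\mathcal D}[f(x,\xi)]$ over $x\in\mathbb R^d$. **Assumptions.** (Lower boundedness) $F\ge F_*>-\infty$. ($L$-smoothness) $F$ is differentiable and $\|\nabla F(x)-\nabla F(y)\|\le L\|x-y\|$ for all $x,y$. ($p$-BCM for gradients) stochastic gradients $\nabla f(x,\xi)$ are available with $\mathbb E[\nabla f(x,\xi)]=\nabla F(x)$ and $\mathbb E[\|\nabla f(x,\xi)-\nabla F(x)\|^p]\le\sigma^p$ for all $x$, $\sigma>0$. ($p$-BCM for Hessians) $F$ is twice differentiable and stochastic Hessian-vector products $\nabla^2f(x,\xi)\cdot v$ are available for every $v\in\mathbb R^d$, with $\mathbb E[\nabla^2f(x,\xi)]=\nabla^2F(x)$ and $\mathbb E[\|\nabla^2f(x,\xi)-\nabla^2F(x)\|_{\mathrm{op}}^p]\le\sigma_h^p$ for all $x$, $\sigma_h>0$. **Clipping.** $\mathtt{clip}(v,\lambda)=\min\{1,\lambda/\|v\|\}\,v$ for $v\ne0$, and $\mathtt{clip}(0,\lambda)=0$. **Algorithm Clip NSGDHess.** Input: $x_0\in\mathbb R^d$, stepsize $\gamma>0$, momentum parameter $\alpha>0$, clipping levels $\lambda>0$ and $\bar\lambda_h>0$, number of iterations $T$; write $\lambda_h=\gamma\bar\lambda_h$. Set $x_1=x_0$, $g_0=0$. For $t=1,\dots,T-1$: sample $q_t$ uniformly on $[0,1]$; set $\hat x_t=q_tx_t+(1-q_t)x_{t-1}$; sample $\xi_t,\hat\xi_t\sim\mathcal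 D$ independently (all samples $q_t,\xi_t,\hat\xi_t$ are independent of each other and of the past); set $$g_t=(1-\alpha)\big(g_{t-1}+\mathtt{clip}(\nabla^2f(\hat x_t,\hat\xi_t)(x_t-x_{t-1}),\lambda_h)\big)+\alpha\,\mathtt{clip}(\nabla f(x_t,\xi_t),\lambda),\qquad x_{t+1}=x_t-\gamma\frac{g_t}{\|g_t\|}.$$ The convention $g/\|g\|=0$ for $g=0$ is used. Each iteration uses one stochastic gradient and one stochastic Hessian-vector product, each counting as an oracle call. $\mathcal O(\cdot)$ records the dominating term for small $\varepsilon$ (the threshold may depend on the problem parameters); the hidden multiplicative constant depends at most on $p$. *)

(* Defs.v *)
From HB Require Import structures.
From mathcomp Require Import all_boot all_order all_algebra.
From mathcomp Require Import finmap.
From mathcomp Require Import all_classical all_reals all_analysis.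

Set Implicit Arguments.
Unset Strict Implicit.
Unset Printing Implicit Defensive.

Import Order.TTheory GRing.Theory Num.Theory.
Import numFieldNormedType.Exports.

Local Open Scope classical_set_scope.
Local Open Scope ring_scope.

(* Vectors of R^d are row vectors and matrices act on the right, as in the
   library's Jacobian ['D_v f x = v *m 'J f x]: the product "A v" is
   [v *m A]. *)

Section euclidean.
Context {R : realType} {d : nat}.

(* The library norm on matrices is the sup norm, whence these definitions. *)
Definition enorm (v : 'rV[R]_d) : R := Num.sqrt (\sum_(j < d) v 0 j ^+ 2).

Definition opnorm (A : 'M[R]_d) : R :=
  sup [set enorm (v *m A) | v in [set v : 'rV[R]_d | enorm v <= 1]].

Definition grad (F : 'rV[R]_d -> R) (x : 'rV[R]_d) : 'rV[R]_d :=
  \row_j 'D_(delta_mx 0 j) F x.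

Definition hess (F : 'rV[R]_d -> R) (x : 'rV[R]_d) : 'M[R]_d := 'J (grad F) x.

Definition twice_differentiable (F : 'rV[R]_d -> R) : Prop :=
  (forall x, differentiable F x) /\ (forall x, differentiable (grad F) x).

Definition smooth (L : R) (F : 'rV[R]_d -> R) : Prop :=
  (forall x, differentiable F x) /\
  (forall x y, enorm (grad F x - grad F y) <= L * enorm (x - y)).

Definition clip (v : 'rV[R]_d) (lambda : R) : 'rV[R]_d :=
  if v == 0 then 0 else Num.min 1 (lambda / enorm v) *: v.

Definition normalize (v : 'rV[R]_d) : 'rV[R]_d :=
  if v == 0 then 0 else (enorm v)^-1 *: v.

End euclidean.

Definition borel_rV (R : realType) (d : nat) :=
  g_sigma_algebraType (@open 'rV[R]_d).

Section stochastic_oracles.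
Context {R : realType} {d : nat} {dXi : measure_display}
  {Xi : measurableType dXi}.
Variable D : probability Xi R.

Definition stochastic_objective (f : 'rV[R]_d -> Xi -> R)
    (F : 'rV[R]_d -> R) : Prop :=
  forall x, D.-integrable setT (EFin \o f x) /\ ('E_D[f x] = (F x)%:E)%E.

(* [gradf x xi] and [hessf x xi] stand for the stochastic gradient and Hessian
   of f at (x, xi). Only what the oracle model grants is required of them: they
   are jointly measurable, unbiased, and have bounded central p-th moments;
   being pathwise derivatives of f is a special case. *)
Definition bcm_gradient (p sigma : R) (F : 'rV[R]_d -> R)
    (gradf : 'rV[R]_d -> Xi -> 'rV[R]_d) : Prop :=
  [/\ forall j, measurable_fun setT
        (fun z : borel_rV R d * Xi => gradf z.1 z.2 0 j),
      forall x j, D.-integrable setT (EFin \o (fun xi => gradf x xi 0 j)) /\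
        ('E_D[fun xi => (gradf x xi 0 j)%R] = (grad F x 0 j)%R%:E)%E
    & forall x, ('E_D[fun xi => (enorm (gradf x xi - grad F x) `^ p)%R]
                 <= (sigma `^ p)%R%:E)%E].

Definition bcm_hessian (p sigma_h : R) (F : 'rV[R]_d -> R)
    (hessf : 'rV[R]_d -> Xi -> 'M[R]_d) : Prop :=
  [/\ forall i j, measurable_fun setT
        (fun z : borel_rV R d * Xi => hessf z.1 z.2 i j),
      forall x i j, D.-integrable setT (EFin \o (fun xi => hessf x xi i j)) /\
        ('E_D[fun xi => (hessf x xi i j)%R] = (hess F x i j)%R%:E)%E
    & forall x, ('E_D[fun xi => (opnorm (hessf x xi - hess F x) `^ p)%R]
                 <= (sigma_h `^ p)%R%:E)%E].

End stochastic_oracles.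

Section algorithm.
Context {R : realType} {d : nat} {Xi : Type}.
Variables (gradf : 'rV[R]_d -> Xi -> 'rV[R]_d)
          (hessf : 'rV[R]_d -> Xi -> 'M[R]_d).
Variables (gamma alpha lambda lambda_h : R) (x0 : 'rV[R]_d).
Variables (q : nat -> R) (xi xih : nat -> Xi).

(* [nsgd_state t] is the triple (x_t, x_{t+1}, g_t). *)
Fixpoint nsgd_state (t : nat) : 'rV[R]_d * 'rV[R]_d * 'rV[R]_d :=
  match t with
  | 0 => (x0, x0, 0)
  | t'.+1 =>
    let: (xprev, x, gprev) := nsgd_state t' in
    let xhat := q t *: x + (1 - q t) *: xprev in
    let g := (1 - alpha) *:
               (gprev + clip ((x - xprev) *m hessf xhat (xih t)) lambda_h)
             + alpha *: clip (gradf x (xi t)) lambda in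
    (x, x - gamma *: normalize g, g)
  end.

Definition nsgd_iterate (t : nat) : 'rV[R]_d := (nsgd_state t).1.1.

End algorithm.

(* Iterations t = 1, ..., T-1, each with one stochastic gradient and one
   stochastic Hessian-vector product. *)
Definition oracle_calls (T : nat) : nat := (2 * T.-1)%N.

Section sampling.
Context {R : realType} {dO dXi : measure_display} {Omega : measurableType dO}
  {Xi : measurableType dXi}.
Variables (P : probability Omega R) (D : probability Xi R).

(* Mutual independence of the set systems [G i], i in S *)
Definition independent_on (I : choiceType) (S : set I)
    (G : I -> set (set Omega)) : Prop :=
  forall (J : {fset I}) (A : I -> set Omega),
    [set` J] `<=` S -> (forall i, i \in J -> G i (A i)) ->
    P (\bigcap_(i in [set` J]) A i) = (\prod_(i <- J) fine (P (A i)))%:E.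

Variables (q : nat -> {RV P >-> R})
          (xi xih : nat -> {RV P >-> Xi}).

(* The draws are indexed by [inl t] for q_t, [inr (inl t)] for xi_t and
   [inr (inr t)] for xih_t. *)
Definition draw_time (i : nat + (nat + nat)) : nat :=
  match i with inl t | inr (inl t) | inr (inr t) => t end.

Definition draw_sigma_algebra (i : nat + (nat + nat)) : set (set Omega) :=
  match i with
  | inl t => g_sigma_algebra_preimage (q t)
  | inr (inl t) => g_sigma_algebra_preimage (xi t)
  | inr (inr t) => g_sigma_algebra_preimage (xih t)
  end.

(* Only the draws at times t = 1, ..., T-1 are constrained. *)
Definition nsgd_samples (T : nat) : Prop :=
  [/\ forall t, (0 < t < T)%N -> forall A, measurable A ->
        distribution P (q t) A = uniform_prob (@ltr01 R) A,
      forall t, (0 < t < T)%N -> forall A, measurable A ->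
        distribution P (xi t) A = D A /\ distribution P (xih t) A = D A
    & independent_on [set i | (0 < draw_time i < T)%N] draw_sigma_algebra].

End sampling.

Section parameters.
Context {R : realType}.

Definition momentum (p : R) (T : nat) : R := T%:R `^ (- (p / (2 * p - 1))).

Definition grad_clip_level (p L sigma Delta1 : R) (T : nat) : R :=
  Num.max (4 * Num.sqrt (L * Delta1)) (sigma / momentum p T `^ p^-1).

Definition hess_clip_level (p L sigma_h gamma : R) (T : nat) : R :=
  2 * gamma * (L + sigma_h) / momentum p T `^ p^-1.

Definition stepsize (c p L sigma sigma_h Delta1 delta : R) (T : nat) : R :=
  let alpha := momentum p T in
  let logTd := ln (T%:R / delta) in
  c * Num.min (Num.sqrt (Delta1 / (L * T%:R)))
     (Num.min (alpha * Num.sqrt (Delta1 / L))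
     (Num.min (Num.sqrt (Delta1 / L) / (alpha * T%:R * logTd))
     (Num.min (Delta1 / (sigma * alpha `^ ((p - 1) / p) * T%:R * logTd))
              (Num.sqrt (Delta1 * alpha `^ p^-1
                         / ((L + sigma_h) * T%:R * logTd)))))).

Definition complexity (p L sigma sigma_h Delta1 delta eps : R) : R :=
  ((Num.sqrt (Delta1 * (L + sigma_h)) + sigma) / eps
   * ln (1 / (delta * eps))) `^ ((2 * p - 1) / (p - 1)).

End parameters.

(* Main.v *)
(* Let e_t = g_t - grad F(x_t). Since the Hessian is sampled at a uniform point
   of the segment, the Hessian-vector product is an unbiased estimate of
   grad F(x_t) - grad F(x_{t-1}), so e_t + (1 - alpha)^t grad F(x_0) is
   (1 - alpha) times its predecessor plus two clipped noises. Dividing by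
   s = alpha lambda / 2 + lambda_h / 2 gives m_t. In one step, the noises
   multiply the conditional expectation of exp (sqrt (1 + |m_t|^2) / 16) by at
   most exp (32 alpha), the bias and variance of clipping both being dominated
   by p-th moments, and the contraction compensates this factor. The expected
   potential thus stays below e^65, and Markov's inequality bounds every |m_t|
   by O(log (T / delta)). As long as these bounds hold, the descent inequality
   keeps F(x_t) - F_* at most 2 Delta_1, hence |grad F(x_t)| at most lambda / 2,
   which is what the noise bounds of the next step require. *)
Require Import Defs.
From HB Require Import structures.
From mathcomp Require Import all_boot all_order all_algebra.
From mathcomp Require Import finmap.
From mathcomp Require Import all_classical all_reals all_analysis.
From mathcomp Require Import ring lra measurable_realfun.

Set Implicit Arguments.
Unset Strict Implicit.
Unset Printing Implicit Defensive.

Import Order.TTheory GRing.Theory Num.Theory.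
Import numFieldNormedType.Exports.

Local Open Scope classical_set_scope.
Local Open Scope ring_scope.

(** * Euclidean norm and clipping *)

(** No constant may depend on the dimension, so coordinates are not treated separately. This shapes
    the potential: the square root of 1 + |m|^2 grows linearly, so that its exponential tolerates
    clipped steps comparable to the unit s, and it is smooth at 0, so that the centred part of a
    noise enters linearly and integrates to zero. Measured in half its clipping level, each noise
    has a [p]-th moment of at most 16 alpha; the cost of a step thus has the order of the
    contraction. Since g_0 = 0, the initial error is - grad F(x_0); its deterministic decay is
    removed from m_t and charged separately, at 2 sqrt (L Delta_1) / alpha over all steps. The
    gradient bound holds only along good histories, so the potential is weighted by the indicator of
    the past bounds. The Hessian is not assumed continuous: the bound, the measurability and the
    integral of its product along a segment come from difference quotients of the Lipschitz
    gradient. Independence is used by integrating the draws one at a time, each against the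
    sigma-algebra of the earlier ones. *)

Section euclidean_space.
Context {R : realType} {d : nat}.
Implicit Types u v w : 'rV[R]_d.

Definition dotp u v : R := \sum_j u 0 j * v 0 j.

Lemma dotpC u v : dotp u v = dotp v u.
Proof. by apply: eq_bigr => j _; rewrite mulrC. Qed.

Lemma dotpDl u v w : dotp (u + v) w = dotp u w + dotp v w.
Proof.
by rewrite -big_split; apply: eq_bigr => j _; rewrite mxE mulrDl.
Qed.

Lemma dotpDr u v w : dotp u (v + w) = dotp u v + dotp u w.
Proof. by rewrite dotpC dotpDl !(dotpC _ u). Qed.

Lemma dotpZl a u v : dotp (a *: u) v = a * dotp u v.
Proof. by rewrite mulr_sumr; apply: eq_bigr => j _; rewrite mxE mulrA. Qed.

Lemma dotpZr a u v : dotp u (a *: v) = a * dotp u v.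
Proof. by rewrite dotpC dotpZl dotpC. Qed.

Lemma dotpNl u v : dotp (- u) v = - dotp u v.
Proof. by rewrite -scaleN1r dotpZl mulN1r. Qed.

Lemma dotpNr u v : dotp u (- v) = - dotp u v.
Proof. by rewrite dotpC dotpNl dotpC. Qed.

Lemma dotp0l v : dotp 0 v = 0.
Proof. by rewrite -(scale0r 0) dotpZl mul0r. Qed.

Lemma enorm_ge0 v : 0 <= enorm v. Proof. exact: sqrtr_ge0. Qed.

Lemma enorm_sqr v : enorm v ^+ 2 = dotp v v.
Proof.
rewrite sqr_sqrtr; last by apply: sumr_ge0 => j _; exact: sqr_ge0.
by apply: eq_bigr => j _; rewrite expr2.
Qed.

Lemma enorm_sqrD u v :
  enorm (u + v) ^+ 2 = enorm u ^+ 2 + 2 * dotp u v + enorm v ^+ 2.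
Proof. by rewrite !enorm_sqr !dotpDl !dotpDr (dotpC v u); ring. Qed.

Lemma enormZ a v : enorm (a *: v) = `|a| * enorm v.
Proof.
apply/eqP; rewrite -(@eqrXn2 _ 2)// ?mulr_ge0 ?enorm_ge0//.
by rewrite enorm_sqr exprMn enorm_sqr dotpZl dotpZr mulrA real_normK ?num_real.
Qed.

Lemma enormN v : enorm (- v) = enorm v.
Proof. by rewrite -scaleN1r enormZ normrN1 mul1r. Qed.

Lemma enormB u v : enorm (u - v) = enorm (v - u).
Proof. by rewrite -enormN opprB. Qed.

Lemma enorm0 : enorm (0 : 'rV[R]_d) = 0.
Proof. by rewrite -(scale0r 0) enormZ normr0 mul0r. Qed.

Lemma coord_le_enorm v j : `|v 0 j| <= enorm v.
Proof.
rewrite -sqrtr_sqr ler_wsqrtr// (bigD1 j)//= lerDl.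
by apply: sumr_ge0 => i _; exact: sqr_ge0.
Qed.

Lemma enorm0_eq0 v : enorm v = 0 -> v = 0.
Proof.
move=> v0; apply/rowP => j; rewrite mxE; apply/eqP; rewrite -normr_le0 -v0.
exact: coord_le_enorm.
Qed.

Lemma enorm_gt0 v : (0 < enorm v) = (v != 0).
Proof.
rewrite lt_def enorm_ge0 andbT; apply/idP/idP; apply: contra_neq.
  by move=> ->; rewrite enorm0.
exact: enorm0_eq0.
Qed.

Lemma cauchy_schwarz u v : dotp u v <= enorm u * enorm v.
Proof.
have [u0|u0] := eqVneq u 0; first by rewrite u0 dotp0l enorm0 mul0r.
have [v0|v0] := eqVneq v 0; first by rewrite v0 dotpC dotp0l enorm0 mulr0.
have := sqr_ge0 (enorm (enorm v *: u - enorm u *: v)).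
rewrite enorm_sqrD enormN !enormZ !ger0_norm ?enorm_ge0// dotpNr dotpZl dotpZr.
move: u0 v0; rewrite -!enorm_gt0 => u0 v0 h.
rewrite -(ler_pM2l (mulr_gt0 u0 v0)).
lra.
Qed.

Lemma cauchy_schwarz_norm u v : `|dotp u v| <= enorm u * enorm v.
Proof.
rewrite ler_norml cauchy_schwarz andbT lerNl -dotpNl.
by rewrite (le_trans (cauchy_schwarz _ _))// enormN.
Qed.

Lemma ler_enormD u v : enorm (u + v) <= enorm u + enorm v.
Proof.
rewrite -(@ler_pXn2r _ 2)// ?nnegrE ?addr_ge0 ?enorm_ge0// enorm_sqrD.
have := cauchy_schwarz u v; nra.
Qed.

Lemma ler_enormB u v : enorm (u - v) <= enorm u + enorm v.
Proof. by rewrite -(enormN v) ler_enormD. Qed.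

Lemma enorm_le_sum v : enorm v <= \sum_j `|v 0 j|.
Proof.
rewrite -(@ler_pXn2r _ 2)// ?nnegrE ?sumr_ge0 ?enorm_ge0// enorm_sqr.
rewrite expr2 mulr_suml; apply: ler_sum => j _.
apply: (le_trans (ler_norm _)); rewrite normrM ler_wpM2l//.
by rewrite (bigD1 j)//= lerDl sumr_ge0.
Qed.

Lemma enorm_normalize v : enorm (normalize v) <= 1.
Proof.
rewrite /normalize; case: eqVneq => [_|v0]; first by rewrite enorm0.
rewrite enormZ ger0_norm ?invr_ge0 ?enorm_ge0// mulVf//.
by rewrite gt_eqF// enorm_gt0.
Qed.

Lemma dotp_normalize v : dotp v (normalize v) = enorm v.
Proof.
rewrite /normalize; case: eqVneq => [->|v0]; first by rewrite dotp0l enorm0.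
by rewrite dotpZr -enorm_sqr expr2 mulKf// gt_eqF// enorm_gt0.
Qed.

Lemma clip_id v l : 0 <= l -> enorm v <= l -> clip v l = v.
Proof.
rewrite /clip; case: eqVneq => // v0 l0 vl.
by rewrite min_l ?scale1r// ler_pdivlMr ?enorm_gt0// mul1r.
Qed.

Lemma clip_gt v l : l < enorm v -> clip v l = (l / enorm v) *: v.
Proof.
rewrite /clip; case: eqVneq => [->|v0 lv]; first by rewrite scaler0.
by rewrite min_r// ler_pdivrMr ?enorm_gt0// mul1r ltW.
Qed.

Lemma enorm_clip v l : 0 <= l -> enorm (clip v l) <= l.
Proof.
move=> l0; have [vl|lv] := leP (enorm v) l; first by rewrite clip_id.
have v0 : 0 < enorm v by exact: le_lt_trans lv.
rewrite clip_gt// enormZ ger0_norm ?divr_ge0 ?enorm_ge0//.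
by rewrite divfK// gt_eqF.
Qed.

Lemma clip_dist v l : 0 <= l -> l < enorm v ->
  enorm (clip v l - v) = enorm v - l.
Proof.
move=> l0 lv; have v0 : 0 < enorm v by exact: le_lt_trans lv.
rewrite clip_gt// (_ : _ - v = (l / enorm v - 1) *: v).
  rewrite enormZ -normrN opprB ger0_norm.
    by field; rewrite gt_eqF.
  by rewrite subr_ge0 ler_pdivrMr// mul1r ltW.
by rewrite scalerBl scale1r.
Qed.

End euclidean_space.

Section operator_norm.
Context {R : realType} {d : nat}.
Implicit Types (v : 'rV[R]_d) (A : 'M[R]_d).

Lemma opnorm_has_sup A :
  has_sup [set enorm (v *m A) | v in [set v : 'rV[R]_d | enorm v <= 1]].
Proof.
split; first by exists (enorm (0 *m A)), 0 => //=; rewrite enorm0.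
exists (\sum_j \sum_i `|A i j|) => _ [v /= v1 <-].
apply: (le_trans (enorm_le_sum _)); apply: ler_sum => j _; rewrite mxE.
apply: (le_trans (ler_norm_sum _ _ _)); apply: ler_sum => i _.
by rewrite normrM ler_piMl// (le_trans (coord_le_enorm _ _)).
Qed.

Lemma opnorm_ge0 A : 0 <= opnorm A.
Proof.
apply: (le_trans (enorm_ge0 (0 *m A))); apply: sup_upper_bound.
  exact: opnorm_has_sup.
by exists 0 => //=; rewrite enorm0.
Qed.

Lemma enorm_mulmx v A : enorm (v *m A) <= enorm v * opnorm A.
Proof.
have [->|v0] := eqVneq v 0; first by rewrite mul0mx enorm0 mul0r.
rewrite -enorm_gt0 in v0.
have : enorm ((enorm v)^-1 *: v *m A) <= opnorm A.
  apply: sup_upper_bound; first exact: opnorm_has_sup.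
  exists ((enorm v)^-1 *: v) => //=.
  by rewrite enormZ ger0_norm ?mulVf ?gt_eqF ?invr_ge0 ?enorm_ge0.
rewrite -scalemxAl enormZ ger0_norm ?invr_ge0 ?enorm_ge0//.
by rewrite mulrC ler_pdivrMr// mulrC.
Qed.

End operator_norm.

(** * The exponential potential *)

Section potential.
Context {R : realType} {d : nat}.
Implicit Types m u x : 'rV[R]_d.

Definition pot x : R := Num.sqrt (1 + enorm x ^+ 2).

Lemma pot_sqr x : pot x ^+ 2 = 1 + enorm x ^+ 2.
Proof. by rewrite sqr_sqrtr// addr_ge0// sqr_ge0. Qed.

Lemma pot_ge1 x : 1 <= pot x.
Proof. by rewrite -{1}sqrtr1 ler_wsqrtr// lerDl sqr_ge0. Qed.

Lemma pot_gt0 x : 0 < pot x.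
Proof. exact: lt_le_trans ltr01 (pot_ge1 x). Qed.

Lemma enorm_le_pot x : enorm x <= pot x.
Proof.
rewrite -(@ler_pXn2r _ 2)// ?nnegrE ?enorm_ge0 ?(ltW (pot_gt0 _))//.
by rewrite pot_sqr lerDr.
Qed.

Lemma pot0 : pot 0 = 1.
Proof. by rewrite /pot enorm0 expr0n addr0 sqrtr1. Qed.

(** Concavity of the square root: the right-hand side is its tangent at [pot m ^+ 2], taken at
    [pot (m + u) ^+ 2], and the gap times [2 * pot m] is a perfect square. *)
Lemma pot_increment m u :
  pot (m + u) <= pot m + (2 * dotp m u + enorm u ^+ 2) / (2 * pot m).
Proof.
have a1 := pot_ge1 m; have a2 := pot_sqr m.
have h2 := pot_sqr (m + u); have h0 := pot_gt0 (m + u).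
rewrite enorm_sqrD in h2.
have m2 : 0 < 2 * pot m by rewrite mulr_gt0// pot_gt0.
rewrite -subr_ge0 -(pmulr_rge0 _ m2).
suff -> : 2 * pot m * (pot m + (2 * dotp m u + enorm u ^+ 2) / (2 * pot m)
   - pot (m + u)) = (pot (m + u) - pot m) ^+ 2 by exact: sqr_ge0.
rewrite mulrBr mulrDr [X in _ + X - _]mulrC divfK ?gt_eqF//.
by rewrite sqrrB h2; lra.
Qed.

End potential.

Section potential_step.
Context {R : realType} {d : nat}.
Implicit Types m u x : 'rV[R]_d.

(** [expR z] is at most [(1 - z)^-1], and [(1 - z) * (1 + z + 2 * z ^+ 2)] equals
    [1 + z ^+ 2 * (1 - 2 * z)], at least 1 for every z up to one half, however negative. *)
Lemma expR_le_quadratic (z : R) : z <= 2^-1 -> expR z <= 1 + z + 2 * z ^+ 2.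
Proof.
move=> z2; rewrite -[z in expR z]opprK expRN.
have z1 : 0 < 1 - z by lra.
apply: (@le_trans _ _ (1 - z)^-1).
  rewrite lef_pV2 ?posrE ?expR_gt0//.
  by rewrite (le_trans _ (expR_ge1Dx _)).
rewrite -[leLHS]mul1r ler_pdivrMr//.
have := sqr_ge0 z; nra.
Qed.

(* The clipping level is twice the bound [l] on the mean, so clipping acts only
   where [X] is at distance at least [l] from its mean. *)
Lemma clip_bias (p l : R) (X mu : 'rV[R]_d) : 1 <= p -> 0 < l ->
  enorm mu <= l ->
  enorm (clip X (2 * l) - X) <= l * (enorm (X - mu) / l) `^ p.
Proof.
move=> p1 l0 mul; have l2 : 0 <= 2 * l by rewrite mulr_ge0// ltW.
have [Xl|lX] := leP (enorm X) (2 * l).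
  by rewrite clip_id// subrr enorm0 mulr_ge0 ?powR_ge0// ltW.
rewrite clip_dist//; have := ler_enormD (X - mu) mu; rewrite subrK => tri.
have r1 : 1 <= enorm (X - mu) / l by rewrite ler_pdivlMr// mul1r; lra.
apply: (@le_trans _ _ (enorm (X - mu))); first by lra.
apply: (@le_trans _ _ (l * (enorm (X - mu) / l))).
  by rewrite mulrC divfK// gt_eqF.
by rewrite ler_pM2l// le1r_powR.
Qed.

(** At distance at least [l] the moment term is at least 1 and absorbs the crude bound [3 * l].
    Closer to the mean nothing is clipped, and a ratio below 1 has its square below its [p]-th power
    because [p <= 2]. *)
Lemma clip_variance (p l : R) (X mu : 'rV[R]_d) : 1 <= p <= 2 -> 0 < l ->
  enorm mu <= l ->
  enorm (clip X (2 * l) - mu) ^+ 2 <= 9 * l ^+ 2 * (enorm (X - mu) / l) `^ p.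
Proof.
move=> /andP[p1 p2] l0 mul; have l2 : 0 <= 2 * l by rewrite mulr_ge0// ltW.
have [r1|r1] := leP 1 (enorm (X - mu) / l).
  have h1 : 1 <= (enorm (X - mu) / l) `^ p.
    by apply: (le_trans r1); exact: le1r_powR.
  have h2 : enorm (clip X (2 * l) - mu) <= 3 * l.
    by rewrite (le_trans (ler_enormB _ _))//; have := enorm_clip X l2; lra.
  have h3 := enorm_ge0 (clip X (2 * l) - mu).
  nra.
have tri := ler_enormD (X - mu) mu; rewrite subrK in tri.
have yl : enorm (X - mu) < l by move: r1; rewrite ltr_pdivrMr// mul1r.
rewrite clip_id//; last by lra.
have [->|y0] := eqVneq (X - mu) 0.
  rewrite enorm0 expr0n mulr_ge0 ?powR_ge0//.
  by have := sqr_ge0 l; lra.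
rewrite -enorm_gt0 in y0.
have : (enorm (X - mu) / l) ^+ 2 <= (enorm (X - mu) / l) `^ p.
  rewrite -powR_mulrn ?divr_ge0 ?(ltW y0) ?(ltW l0)// ger_powR//.
  by rewrite divr_gt0//= ltW.
rewrite expr_div_n ler_pdivrMr ?exprn_gt0// => h.
apply: (le_trans h); rewrite mulrC ler_wpM2r ?powR_ge0//.
by rewrite ler_peMl ?sqr_ge0// ler1n.
Qed.

(* Both the clipping bias and the second-order remainder are dominated by the
   [p]-th moment term; the linear term vanishes once [X] is integrated. *)
Lemma expR_pot_step (p l b : R) (m X mu : 'rV[R]_d) :
  1 <= p <= 2 -> 0 < l -> 0 <= b -> b * l <= 1 -> enorm mu <= l ->
  expR (16^-1 * pot (m + b *: (clip X (2 * l) - mu))) <=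
  expR (16^-1 * pot m) *
    (1 + dotp ((16^-1 * b / pot m) *: m) (X - mu)
       + (enorm (X - mu) / l) `^ p).
Proof.
move=> p12 l0 b0 bl mul; have /andP[p1 _] := p12.
have l2 : 0 <= 2 * l by rewrite mulr_ge0// ltW.
set u := b *: _; set eta := _ `^ p.
have eta0 : 0 <= eta by exact: powR_ge0.
set a := pot m; have a1 : 1 <= a := pot_ge1 m.
have a0 : 0 < a := pot_gt0 m.
have ma : enorm m <= a := enorm_le_pot m.
have m0 := enorm_ge0 m.
have u0 := enorm_ge0 u.
have uE : enorm u = b * enorm (clip X (2 * l) - mu).
  by rewrite enormZ ger0_norm.
have u3 : enorm u <= 3.
  have : enorm (clip X (2 * l) - mu) <= 3 * l.
    by rewrite (le_trans (ler_enormB _ _))//; have := enorm_clip X l2; lra.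
  by rewrite uE; nra.
have u2 : enorm u ^+ 2 <= 9 * eta.
  have h := clip_variance X p12 l0 mul; rewrite -/eta in h.
  have bl2 : (b * l) ^+ 2 <= 1 by rewrite expr_le1// mulr_ge0// ltW.
  rewrite uE exprMn; apply: (le_trans (ler_wpM2l (sqr_ge0 b) h)).
  have -> : b ^+ 2 * (9 * l ^+ 2 * eta) = 9 * eta * (b * l) ^+ 2 by ring.
  by rewrite ler_piMr// mulr_ge0.
have mu1 : dotp m u <= b * dotp m (X - mu) + a * eta.
  rewrite (_ : u = b *: (X - mu) + b *: (clip X (2 * l) - X)); last first.
    by rewrite -scalerDr; congr (_ *: _); rewrite [RHS]addrC addrA subrK.
  rewrite (dotpDr m (b *: _)) !dotpZr lerD2l.
  have h1 := cauchy_schwarz m (clip X (2 * l) - X).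
  have h2 := clip_bias X p1 l0 mul; rewrite -/eta in h2.
  have h3 : dotp m (clip X (2 * l) - X) <= a * (l * eta).
    apply: (le_trans h1); apply: ler_pM => //; exact: enorm_ge0.
  apply: (le_trans (ler_wpM2l b0 h3)).
  have -> : b * (a * (l * eta)) = b * l * (a * eta) by ring.
  by rewrite ler_piMl// mulr_ge0// ltW.
set Y := (2 * dotp m u + enorm u ^+ 2) / (2 * a).
have YE : Y = dotp m u / a + enorm u ^+ 2 / (2 * a).
  by rewrite /Y; field; rewrite gt_eqF.
have ha : `|dotp m u / a| <= enorm u.
  have ia : 0 < a^-1 by rewrite invr_gt0.
  rewrite normrM (gtr0_norm ia) ler_pdivrMr//.
  apply: (le_trans (cauchy_schwarz_norm _ _)); rewrite mulrC.
  by rewrite ler_wpM2l.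
have hb0 : 0 <= enorm u ^+ 2 / (2 * a).
  by rewrite divr_ge0 ?sqr_ge0// mulr_ge0// ltW.
have hb : enorm u ^+ 2 / (2 * a) <= enorm u ^+ 2 / 2.
  by rewrite ler_pdivrMr ?mulr_gt0//; have := sqr_ge0 (enorm u); nra.
have Yu : `|Y| <= 5 / 2 * enorm u.
  rewrite YE; apply: (le_trans (ler_normD _ _)).
  by rewrite (ger0_norm hb0); nra.
have Y2 : Y ^+ 2 <= 25 / 4 * (9 * eta).
  have : `|Y| ^+ 2 <= (5 / 2 * enorm u) ^+ 2.
    by rewrite ler_pXn2r// nnegrE mulr_ge0.
  by rewrite real_normK ?num_real//; nra.
have Yle : Y <= 15 / 2 by have := ler_norm Y; nra.
have Yeta : Y <= b * dotp m (X - mu) / a + eta + 9 / 2 * eta.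
  rewrite YE; apply: lerD; last by lra.
  by rewrite ler_pdivrMr// mulrDl divfK ?gt_eqF// (mulrC eta).
apply: (@le_trans _ _ (expR (16^-1 * a) * expR (16^-1 * Y))).
  by rewrite -expRD ler_expR -mulrDr ler_pM2l ?invr_gt0// pot_increment.
rewrite ler_pM2l ?expR_gt0//.
(* The factor 1/16 serves two needs: [16^-1 * Y] is at most 15/32, within the range of the quadratic
   bound, and [eta] collects 11/32 from the linear term and 2/256 of 225/4 from the square, in total
   less than 1. *)
apply: (le_trans (expR_le_quadratic _)); first by lra.
have -> : dotp ((16^-1 * b / a) *: m) (X - mu) =
    16^-1 * (b * dotp m (X - mu) / a).
  by rewrite dotpZl; field; rewrite gt_eqF.
nra.
Qed.

(** The values of [expR] at 0 and [x] lie above its tangent at [t * x]; averaging them with weights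
    [1 - t] and [t] cancels the slope. *)
Lemma expR_convex (t x : R) : 0 <= t <= 1 ->
  expR (t * x) <= (1 - t) + t * expR x.
Proof.
move=> /andP[t0 t1].
have h1 : expR (t * x) * (1 + (1 - t) * x) <= expR x.
  have -> : expR x = expR (t * x) * expR ((1 - t) * x).
    by rewrite -expRD; congr expR; ring.
  by rewrite ler_pM2l ?expR_gt0// expR_ge1Dx.
have h2 : expR (t * x) * (1 + - (t * x)) <= 1.
  have {2}-> : 1 = expR (t * x) * expR (- (t * x)) by rewrite -expRD subrr expR0.
  by rewrite ler_pM2l ?expR_gt0// expR_ge1Dx.
have t1' : 0 <= 1 - t by rewrite subr_ge0.
have -> : expR (t * x) = (1 - t) * (expR (t * x) * (1 + - (t * x))) +
    t * (expR (t * x) * (1 + (1 - t) * x)) by ring.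
by rewrite -{3}(mulr1 (1 - t)); apply: lerD; apply: ler_wpM2l.
Qed.

(** The 1 under the root is not contracted, so only the excess [pot m - 1] shrinks. The rate [t / 2]
    is not sharp (convexity gives [t]) but suffices for the drift. *)
Lemma pot_contract (t : R) m : 0 <= t <= 1 ->
  pot ((1 - t) *: m) <= pot m - t * (pot m - 1) / 2.
Proof.
move=> /andP[t0 t1]; have a1 := pot_ge1 m.
rewrite -(@ler_pXn2r _ 2)// ?nnegrE; last 2 first.
- exact/ltW/pot_gt0.
- by nra.
rewrite pot_sqr enormZ exprMn real_normK ?num_real//.
have := pot_sqr m; set a := pot m in a1 *; set e := enorm m ^+ 2 => ae.
have -> : e = a ^+ 2 - 1 by rewrite ae; ring.
rewrite -subr_ge0.
have -> : (a - t * (a - 1) / 2) ^+ 2 - (1 + (1 - t) ^+ 2 * (a ^+ 2 - 1)) =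
  2 * t * (a - 1) * (3 / 2 - t) + t * (a - 1) ^+ 2 * (1 - 3 / 4 * t) by field.
by rewrite addr_ge0// !mulr_ge0//; lra.
Qed.

(* Each of the two noise steps of an iteration costs [16 t]. The contraction
   beats their sum once [pot m > 1025], whence the constant [expR 65]. *)
Lemma expR_pot_drift (t : R) m : 0 <= t <= 1 ->
  expR (16^-1 * pot ((1 - t) *: m) + 32 * t) <=
  (1 - t / 2) * expR (16^-1 * pot m) + t / 2 * expR 65.
Proof.
move=> t01; have /andP[t0 t1] := t01.
have hc := pot_contract m t01; set a := pot m in hc *.
set x := 32 - 16^-1 * (a - 1) / 2.
apply: (@le_trans _ _ (expR (16^-1 * a) * expR (t * x))).
  by rewrite -expRD ler_expR /x; lra.
have h1 := expR_convex x t01.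
(* Half of the exponent of [expR (16^-1 * a)] cancels, which leaves the geometric mean of that
   factor and of the exponential of 64 + 1/16; the arithmetic mean bounds it. *)
have h2 : expR (16^-1 * a) * expR x <= (expR (16^-1 * a) + expR 65) / 2.
  have -> : expR (16^-1 * a) * expR x =
      expR (16^-1 * a / 2) * expR (32 + 16^-1 / 2).
    by rewrite -!expRD; congr expR; rewrite /x; field.
  have -> : expR (16^-1 * a) = expR (16^-1 * a / 2) ^+ 2.
    by rewrite expr2 -expRD; congr expR; field.
  have : expR (32 + 16^-1 / 2) ^+ 2 <= expR 65 :> R.
    by rewrite expr2 -expRD ler_expR; lra.
  have := sqr_ge0 (expR (16^-1 * a / 2) - expR (32 + 16^-1 / 2)); nra.
have := expR_gt0 (16^-1 * a).
have : expR (16^-1 * a) * expR (t * x) <=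
       expR (16^-1 * a) * (1 - t + t * expR x).
  by rewrite ler_pM2l// expR_gt0.
nra.
Qed.

End potential_step.

(** * Measurability of vector-valued maps *)

Section borel_vectors.
Context {R : realType} {d : nat}.

Let box (c : 'rV[rat]_d) (n : nat) : set 'rV[R]_d :=
  [set y | forall j, `|ratr (c 0 j) - y 0 j| < n.+1%:R^-1].

(** Second countability, with rational boxes rather than balls of [enorm]: the preimage of a box is
    a finite intersection of coordinate preimages, which coordinatewise measurability controls. *)
Lemma open_bigcup_box (U : set 'rV[R]_d) : open U ->
  U = \bigcup_(k in [set k : 'rV[rat]_d * nat | box k.1 k.2 `<=` U])
        box k.1 k.2.
Proof.
move=> oU; apply/seteqP; split => [y Uy|y [k kU]]; last exact: kU.
have /nbhs_ballP[e /= e0 eU] := open_nbhs_nbhs (conj oU Uy).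
have [n ne] : exists n, n.+1%:R^-1 < e / 2.
  exists (Num.trunc (e / 2)^-1); rewrite invf_plt ?posrE ?divr_gt0//.
  by rewrite truncnS_gt.
have [dl dlE] : exists dl : R, dl = n.+1%:R^-1 by exists n.+1%:R^-1.
have n0 : 0 < dl by rewrite dlE invr_gt0.
rewrite -dlE in ne.
have /choice[c cP] : forall j, exists q : rat, `|ratr q - y 0 j| < dl.
  move=> j; have : y 0 j - dl < y 0 j + dl by lra.
  move=> /rat_in_itvoo[q]; rewrite in_itv/= => /andP[q1 q2].
  by exists q; rewrite ltr_norml; apply/andP; split; lra.
exists (\row_j c j, n) => /=; last by move=> j; rewrite mxE -dlE.
move=> z zc; apply: eU; split=> // i j; rewrite ord1 /ball/=.
have := zc j; rewrite mxE -dlE => h1; have := cP j.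
rewrite distrC => h2; rewrite (_ : y 0 j - z 0 j =
  (y 0 j - ratr (c j)) + (ratr (c j) - z 0 j)); last by ring.
by rewrite (le_lt_trans (ler_normD _ _))//; lra.
Qed.

Context {dT : measure_display} {T : measurableType dT}.

Definition measurable_coord (f : T -> 'rV[R]_d) :=
  forall j, measurable_fun setT (fun t => f t 0 j).

(** Reconciles the two notions in play: the oracles are measurable for the Borel sets of R^d, while
    the iterates are followed coordinate by coordinate. *)
Lemma measurable_borel_rV (f : T -> 'rV[R]_d) : measurable_coord f ->
  measurable_fun setT (f : T -> borel_rV R d).
Proof.
move=> mf; apply: (@measurability _ _ T (borel_rV R d) setT f (@open 'rV[R]_d)) => //.
move=> _ [U oU <-]; rewrite setTI (open_bigcup_box oU) preimage_bigcup.
have box_meas k : measurable (f @^-1` box k.1 k.2).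
  rewrite (_ : _ @^-1` _ = \bigcap_(j in [set: 'I_d])
     ((fun t => f t 0 j) @^-1` ball (ratr (k.1 0 j) : R) k.2.+1%:R^-1)).
    apply: fin_bigcap_measurable => //.
    by move=> j _; rewrite -[X in measurable X]setTI; apply: mf => //;
       apply: open_measurable; exact: ball_open.
  by apply/seteqP; split => t /= h j => [_|]; exact: h.
rewrite bigcup_mkcond; set B := fun k => if _ then _ else _.
have mB k : measurable (B k).
  by rewrite /B; case: ifPn => // _; exact: measurable0.
(* The boxes are indexed by a countable type; its codes turn the union into one over the natural
   numbers. *)
pose C (n : nat) : set T := if @choice.unpickle ('rV[rat]_d * nat)%type n is Some k
  then B k else set0.
rewrite (_ : bigcup _ _ = bigcup setT C).
  apply: bigcup_measurable => n _; rewrite /C; case: choice.unpickle => [k|].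
    exact: mB.
  exact: measurable0.
apply/seteqP; split => [t [k _ h]|t [n _]].
  by exists (choice.pickle k) => //; rewrite /C choice.pickleK.
by rewrite /C; case: choice.unpickle => [k|]// h; exists k.
Qed.

Lemma continuous_borel_rV (f : 'rV[R]_d -> R) : continuous f ->
  measurable_fun setT (f : borel_rV R d -> R).
Proof.
move=> cf; apply: (measurability _ (RGenOInfty.measurableE R)) => //.
move=> _ [_ [x ->] <-]; rewrite setTI; apply: sub_sigma_algebra.
by move/continuousP : cf; apply; exact: interval_open.
Qed.

End borel_vectors.

Section measurable_vectors.
Context {R : realType} {d : nat} {dT : measure_display} {T : measurableType dT}.
Implicit Types (f g : T -> 'rV[R]_d) (h : T -> R).

(** Squaring puts the inverse on a nonnegative base, where it is a real power; where [h] vanishes,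
    both sides are 0 by the convention on inverses. *)
Lemma measurable_invr h : measurable_fun setT h ->
  measurable_fun setT (fun t => (h t)^-1).
Proof.
move=> mh; rewrite (_ : (fun t => _) = (fun t => h t * (h t ^+ 2) `^ (-1))).
  apply: measurable_funM => //.
  exact: (measurableT_comp (measurable_powR (-1)) (measurable_funX 2 mh)).
apply/funext => t; rewrite powR_inv1 ?sqr_ge0//.
have [->|ht] := eqVneq (h t) 0; first by rewrite invr0 mul0r.
by rewrite expr2 invfM mulrA mulfV ?mul1r.
Qed.

Lemma measurable_sqrtr h : measurable_fun setT h ->
  (forall t, 0 <= h t) -> measurable_fun setT (fun t => Num.sqrt (h t)).
Proof.
move=> mh h0; rewrite (_ : (fun t => _) = (fun t => h t `^ 2^-1)).
  exact: (measurableT_comp (measurable_powR 2^-1) mh).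
by apply/funext => t; rewrite powR12_sqrt.
Qed.

Lemma measurable_coord_cst (v : 'rV[R]_d) :
  measurable_coord (fun _ : T => v).
Proof. by move=> j; exact: measurable_cst. Qed.

Lemma measurable_coordD f g : measurable_coord f -> measurable_coord g ->
  measurable_coord (fun t => f t + g t).
Proof.
move=> mf mg j; rewrite (_ : (fun t => _) = (fun t => f t 0 j + g t 0 j)).
  exact: measurable_funD.
by apply/funext => t; rewrite mxE.
Qed.

Lemma measurable_coordZ h f : measurable_fun setT h -> measurable_coord f ->
  measurable_coord (fun t => h t *: f t).
Proof.
move=> mh mf j; rewrite (_ : (fun t => _) = (fun t => h t * f t 0 j)).
  exact: measurable_funM.
by apply/funext => t; rewrite mxE.
Qed.

Lemma measurable_coordN f : measurable_coord f ->
  measurable_coord (fun t => - f t).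
Proof.
move=> mf; rewrite (_ : (fun t => _) = (fun t => -1 *: f t)).
  by apply: measurable_coordZ => //; exact: measurable_cst.
by apply/funext => t; rewrite scaleN1r.
Qed.

Lemma measurable_coordB f g : measurable_coord f -> measurable_coord g ->
  measurable_coord (fun t => f t - g t).
Proof. by move=> mf mg; apply/measurable_coordD/measurable_coordN. Qed.

Lemma measurable_coord_mulmx f (A : T -> 'M[R]_d) : measurable_coord f ->
  (forall i j, measurable_fun setT (fun t => A t i j)) ->
  measurable_coord (fun t => f t *m A t).
Proof.
move=> mf mA j.
rewrite (_ : (fun t => _) = (fun t => \sum_i (f t 0 i * A t i j))).
  by apply: measurable_sum => i; exact: measurable_funM.
by apply/funext => t; rewrite mxE.
Qed.

Lemma measurable_enorm f : measurable_coord f ->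
  measurable_fun setT (fun t => enorm (f t)).
Proof.
move=> mf; apply: measurable_sqrtr.
  by apply: measurable_sum => j; exact: measurable_funX.
by move=> t; apply: sumr_ge0 => j _; exact: sqr_ge0.
Qed.

Lemma measurable_pot f : measurable_coord f ->
  measurable_fun setT (fun t => pot (f t)).
Proof.
move=> mf; apply: measurable_sqrtr.
  apply: measurable_funD => //; apply: measurable_funX.
  exact: measurable_enorm.
by move=> t; rewrite addr_ge0// sqr_ge0.
Qed.

Lemma measurable_coord_clip f l : measurable_coord f ->
  measurable_coord (fun t => clip (f t) l).
Proof.
move=> mf.
rewrite (_ : (fun t => _) = (fun t => Num.min 1 (l / enorm (f t)) *: f t)).
  apply: measurable_coordZ => //; apply: measurable_minr => //.
  by apply: measurable_funM => //; apply/measurable_invr/measurable_enorm.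
by apply/funext => t; rewrite /clip; case: eqVneq => // ->; rewrite scaler0.
Qed.

Lemma measurable_coord_normalize f : measurable_coord f ->
  measurable_coord (fun t => normalize (f t)).
Proof.
move=> mf; rewrite (_ : (fun t => _) = (fun t => (enorm (f t))^-1 *: f t)).
  by apply: measurable_coordZ => //; apply/measurable_invr/measurable_enorm.
by apply/funext => t; rewrite /normalize; case: eqVneq => // ->; rewrite scaler0.
Qed.

End measurable_vectors.

(** * Integrating out an independent draw *)

Section independent_draws.
Context {R : realType} {dO : measure_display} {Omega : measurableType dO}.
Variable P : probability Omega R.

(* Measurability of [Phi] in [<<s G >>] lets the integrand depend on the whole
   past without encoding that past in a product space. *)
Lemma integral_fresh (dY : measure_display) (Y : measurableType dY)
    (nu : probability Y R) (G : set (set Omega)) (X : Omega -> Y)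
    (Phi : g_sigma_algebraType G * Y -> \bar R) :
  setI_closed G -> G `<=` measurable -> measurable_fun setT X ->
  (forall B, measurable B -> P (X @^-1` B) = nu B) ->
  (forall A B, G A -> measurable B ->
    P (A `&` X @^-1` B) = (P A * P (X @^-1` B))%E) ->
  measurable_fun setT Phi -> (forall z, 0 <= Phi z)%E ->
  (\int[P]_w Phi (w, X w) = \int[P]_w \int[nu]_y Phi (w, y))%E.
Proof.
move=> GI Gm mX lawX indep mPhi Phi0.
have sGm : <<s G >> `<=` @measurable _ Omega.
  apply: smallest_sub => //; split => [|A mA|F mF]; first exact: measurable0.
    by rewrite setTD; exact: measurableC.
  exact: bigcup_measurable.
pose toG (w : Omega) : g_sigma_algebraType G := w.
have mid : measurable_fun setT toG.
  by move=> _ A mA; rewrite setTI; exact: sGm.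
have mXpre B : measurable B -> measurable (X @^-1` B).
  by move=> mB; rewrite -[X in measurable X]setTI; exact: mX.
have indepC (A : set Omega) B : measurable A -> measurable B ->
    P (A `&` X @^-1` B) = (P A * P (X @^-1` B))%E ->
    P (~` A `&` X @^-1` B) = (P (~` A) * P (X @^-1` B))%E.
  move=> mA mB PA; have mXB := mXpre _ mB.
  have fA := fin_num_measure P _ mA; have fB := fin_num_measure P _ mXB.
  have -> : P (~` A `&` X @^-1` B) =
      (P (X @^-1` B) - P (A `&` X @^-1` B))%E.
    by rewrite setIC -setDE measureD// 1?setIC// ltey_eq fB.
  rewrite PA probability_setC// -(fineK fA) -(fineK fB).
  by rewrite -EFinM -!EFinB -EFinM; congr EFin; ring.
have indepU (F : (set Omega)^nat) B : (forall n, measurable (F n)) ->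
    measurable B -> trivIset [set: nat] F ->
    (forall n, P (F n `&` X @^-1` B) = (P (F n) * P (X @^-1` B))%E) ->
    P (\bigcup_n F n `&` X @^-1` B) = (P (\bigcup_n F n) * P (X @^-1` B))%E.
  move=> mF mB tF PF; have mXB := mXpre _ mB.
  rewrite setI_bigcupl measure_bigcup//; last 2 first.
  - by move=> n _; exact: measurableI.
  - apply/trivIsetP => i j _ _ ij; move/trivIsetP : tF => /(_ i j I I ij) h.
    by rewrite setIACA h set0I.
  have fB := fin_num_measure P _ mXB.
  rewrite measure_bigcup// muleC -(fineK fB) -nneseriesZl//.
  by apply: eq_eseriesr => n _; rewrite fineK// muleC; exact: PF.
(* The events satisfying the product rule are stable under complement and disjoint union, hence
   contain the sigma-algebra of the pi-system [G]. *)
have {}indep A B : <<s G >> A -> measurable B ->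
    P (A `&` X @^-1` B) = (P A * P (X @^-1` B))%E.
  move=> GA mB; move: A GA.
  apply: (@dynkin_induction _ (g_sigma_algebraType G) G) => //.
  - by rewrite setTI probability_setT mul1e.
  - by move=> A GA; exact: indep.
  - by move=> A /sGm mA; exact: indepC.
  - by move=> F mF tF PF; apply: indepU => // n; apply: sGm; exact: mF.
pose idM := isMeasurableFun.Build _ _ _ _ _ mid.
pose idG : {mfun Omega >-> g_sigma_algebraType G} := HB.pack toG idM.
pose pairX (w : Omega) : g_sigma_algebraType G * Y := (w, X w).
have mW : measurable_fun setT pairX by exact: measurable_fun_pair.
pose WM := isMeasurableFun.Build _ _ _ _ _ mW.
pose W : {mfun Omega >-> (g_sigma_algebraType G * Y)%type} :=
  HB.pack pairX WM.
transitivity (\int[distribution P W]_z Phi z)%E.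
  by rewrite ge0_integral_distribution.
(* The pair made of the identity, read on the coarser sigma-algebra, and of [X] has the product law,
   since both measures agree on rectangles. Tonelli then integrates the fresh draw first. *)
transitivity (\int[(distribution P idG \x nu)%E]_z Phi z)%E.
  apply: eq_measure_integral => A mA _; apply/esym.
  apply: product_measure_unique => // B C mB mC.
  by rewrite /= /pushforward /= -lawX// -indep.
rewrite fubini_tonelli1// ge0_integral_distribution//.
  exact: measurable_fun_fubini_tonelli_F.
by move=> w; exact: integral_ge0.
Qed.

Variables (I : choiceType) (G : I -> set (set Omega)).
Hypothesis GI : forall i, setI_closed (G i).
Hypothesis GT : forall i, G i setT.
Hypothesis Gm : forall i, G i `<=` measurable.

(** The pi-system to which mutual independence applies directly, and which generates the
    sigma-algebra of the draws in [S]. Events are required at every index, so that two cylinders can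
    be intersected index by index, with [setT] as filler. *)
Definition cylinders (S : set I) : set (set Omega) :=
  [set B | exists (J : {fset I}) (A : I -> set Omega),
    [/\ [set` J] `<=` S, forall i, G i (A i) &
        B = \bigcap_(i in [set` J]) A i]].

Lemma cylinders_measurable S : cylinders S `<=` measurable.
Proof.
move=> _ [J [A [_ GA ->]]]; apply: fin_bigcap_measurable => // i _.
exact/Gm/GA.
Qed.

Lemma cylinders_setI S : setI_closed (cylinders S).
Proof.
move=> _ _ [J [A [JS GA ->]]] [K [B [KS GB ->]]].
exists (J `|` K)%fset, (fun i => (if i \in J then A i else setT) `&`
  (if i \in K then B i else setT)); split.
- by move=> i /=; rewrite inE => /orP[/JS|/KS].
- by move=> i; apply: GI; case: ifP => _.
apply/seteqP; split => [w [hA hB] i /= _|w h].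
  by split; case: ifPn => // iJ; [exact: hA|exact: hB].
split=> i /= iJ.
  by have [|+ _] := h i; rewrite /= ?inE iJ.
by have [|_] := h i; rewrite /= ?inE iJ ?orbT.
Qed.

Lemma cylinders_sub S S' : S `<=` S' -> cylinders S `<=` cylinders S'.
Proof.
move=> SS' _ [J [A [JS GA ->]]]; exists J, A; split => //.
exact: subset_trans SS'.
Qed.

Lemma sub_cylinders (S : set I) i A : S i -> G i A -> cylinders S A.
Proof.
move=> Si GA; exists [fset i]%fset, (fun j => if j == i then A else setT).
split; [by move=> j /=; rewrite inE => /eqP ->|by move=> j; case: eqVneq => [->|]|].
apply/seteqP; split => [w Aw j /=|w]; first by rewrite inE => ->.
by move=> /(_ i); rewrite /= inE eqxx; exact.
Qed.

(** Mutual independence is used for [J] and for [J] enlarged by [j]; the two products differ by the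
    factor of [B]. *)
Lemma cylinders_indep (S S' : set I) j A B : independent_on P S' G ->
  S `<=` S' -> S' j -> ~ S j -> cylinders S A -> G j B ->
  P (A `&` B) = (P A * P B)%E.
Proof.
move=> ind SS' S'j nSj [J [C [JS GC ->]]] GB.
have jJ : j \notin J by apply/negP => /JS.
pose C' i := if i == j then B else C i.
have := ind (j |` J)%fset C'; rewrite big_fsetU1//= => h.
transitivity (P (\bigcap_(i in [set` (j |` J)%fset]) C' i)).
  congr (P _); apply/seteqP; split => [w [hC hB] i /=|w h'].
    rewrite /C' !inE => /orP[/eqP ->|iJ]; first by rewrite eqxx.
    by case: eqVneq => [//|_]; exact: hC.
  split=> [i /= iJ|].
    have := h' i; rewrite /C' /= !inE iJ orbT; case: eqVneq => [ij|_]; last exact.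
    by rewrite -ij iJ in jJ.
  by have := h' j; rewrite /C' /= !inE eqxx; exact.
rewrite h; last 2 first.
- by move=> i /=; rewrite !inE => /orP[/eqP ->|/JS/SS'].
- by move=> i _; rewrite /C'; case: eqVneq => [->|].
rewrite {1}/C' eqxx EFinM muleC; congr (_ * _)%E; last first.
  by rewrite fineK// fin_num_measure//; exact: (Gm GB).
rewrite ind//; last exact: subset_trans SS'.
congr EFin; apply: eq_big_seq => i iJ; rewrite /C'; case: eqVneq => // ij.
by rewrite -ij iJ in jJ.
Qed.

Notation OmegaS S := (g_sigma_algebraType (cylinders S)).

Lemma measurable_fun_cylinders_sub (S S' : set I) (dY : measure_display)
    (Y : measurableType dY) (f : Omega -> Y) : S `<=` S' ->
  measurable_fun setT (f : OmegaS S -> Y) ->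
  measurable_fun setT (f : OmegaS S' -> Y).
Proof.
move=> SS' mf _ A mA.
exact: (sub_sigma_algebra2 (cylinders_sub SS') (mf measurableT A mA)).
Qed.

Lemma measurable_fun_cylinders (S : set I) (dY : measure_display)
    (Y : measurableType dY) (f : Omega -> Y) :
  measurable_fun setT (f : OmegaS S -> Y) -> measurable_fun setT f.
Proof.
move=> mf _ A mA; have := mf measurableT A mA; rewrite !setTI.
apply: smallest_sub; last exact: cylinders_measurable.
split => [|B mB|F mF]; first exact: measurable0.
  by rewrite setTD; exact: measurableC.
exact: bigcup_measurable.
Qed.

Lemma measurable_draw (S : set I) i (dY : measure_display)
    (Y : measurableType dY) (X : Omega -> Y) : S i ->
  (forall B, measurable B -> G i (X @^-1` B)) ->
  measurable_fun setT (X : OmegaS S -> Y).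
Proof.
move=> Si GX _ B mB; rewrite setTI; apply: sub_sigma_algebra.
exact: sub_cylinders (GX _ mB).
Qed.

Lemma integral_fresh_draw (S S' : set I) j (dY : measure_display)
    (Y : measurableType dY) (nu : probability Y R) (X : Omega -> Y)
    (Phi : OmegaS S * Y -> \bar R) : independent_on P S' G ->
  S `<=` S' -> S' j -> ~ S j ->
  (forall B, measurable B -> G j (X @^-1` B)) ->
  (forall B, measurable B -> P (X @^-1` B) = nu B) ->
  measurable_fun setT Phi -> (forall z, 0 <= Phi z)%E ->
  (\int[P]_w Phi (w, X w) = \int[P]_w \int[nu]_y Phi (w, y))%E.
Proof.
move=> ind SS' S'j nSj GX lawX mPhi Phi0.
apply: integral_fresh => //.
- exact: cylinders_setI.
- exact: cylinders_measurable.
- by move=> _ B mB; rewrite setTI; exact/Gm/GX.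
by move=> A B cA mB; exact: (cylinders_indep ind SS' S'j nSj cA (GX _ mB)).
Qed.

End independent_draws.

(** * Smooth functions *)

Section directional_derivatives.
Context {R : realType} {d : nat}.
Implicit Types (x v : 'rV[R]_d) (F : 'rV[R]_d -> R).

Lemma is_derive_line (W : normedModType R) (f : 'rV[R]_d -> W) x v (t : R) :
  differentiable f (x + t *: v) ->
  is_derive t 1 (fun s : R => f (x + s *: v)) ('D_v f (x + t *: v)).
Proof.
move=> dfx; have dfv : derivable f (x + t *: v) v by exact: diff_derivable.
have E : (fun h : R => h^-1 *: (((fun s : R => f (x + s *: v)) \o shift t)
    (h *: (1 : R)) - f (x + t *: v))) =
  (fun h : R => h^-1 *: ((f \o shift (x + t *: v)) (h *: v) - f (x + t *: v))).
  apply/funext => h /=; congr (_ *: (f _ - _)).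
  by rewrite /shift /= [h *: 1]mulr1 scalerDl addrCA.
apply: DeriveDef; first by rewrite /derivable E.
by rewrite /derive E.
Qed.

Lemma derive_grad F x v : differentiable F x -> 'D_v F x = dotp (grad F x) v.
Proof.
move=> dF; rewrite deriveE// {1}(row_sum_delta v) linear_sum.
by apply: eq_bigr => j _; rewrite linearZ/= -deriveE// mxE mulrC.
Qed.

Variables (L : R) (F : 'rV[R]_d -> R).
Hypothesis smoothF : smooth L F.

Let dF x : differentiable F x := smoothF.1 x.

(** Mean value theorem for [F] along the segment minus a parabola: the slope of the parabola absorbs
    the growth of the gradient at the intermediate point, so nothing has to be integrated. *)
Lemma descent_lemma x v :
  F (x + v) <= F x + dotp (grad F x) v + L / 2 * enorm v ^+ 2.
Proof.
pose phi (t : R) := F (x + t *: v) - L / 2 * enorm v ^+ 2 * t ^+ 2.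
pose dphi (t : R) := dotp (grad F (x + t *: v)) v - L * enorm v ^+ 2 * t.
have dphiP (t : R) : is_derive t 1 phi (dphi t).
  have h1 := is_derive_line (dF (x + t *: v)); rewrite derive_grad// in h1.
  have h2 := is_deriveZ (L / 2 * enorm v ^+ 2) (is_deriveX 2 (is_derive_id t 1)).
  have h3 := is_deriveB h1 h2.
  rewrite (_ : phi = (fun s => F (x + s *: v)) -
      (L / 2 * enorm v ^+ 2) \*: (id ^+ 2)); last first.
    by apply/funext => s; rewrite /phi !fctE.
  apply: (is_derive_eq h3).
  rewrite /dphi /= expr1 [_%:A]mulr1 [X in _ - X]/(_ * _).
  congr (_ - _); transitivity (L / 2 * enorm v ^+ 2 * (2 * t)); first by [].
  by field.
have cphi : {within `[0, 1], continuous phi}.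
  apply: derivable_within_continuous => t _.
  by have [] := dphiP t.
have [c + cE] := MVT ltr01 (fun t _ => dphiP t) cphi.
rewrite in_itv/= => /andP[c0 c1]; move: cE.
rewrite /phi /dphi scale1r scale0r addr0 expr1n expr0n /= subr0 mulr0 mulr1 subr0.
have h1 := cauchy_schwarz (grad F (x + c *: v) - grad F x) v.
have h2 := smoothF.2 (x + c *: v) x.
rewrite addrAC subrr add0r enormZ (gtr0_norm c0) in h2.
rewrite dotpDl dotpNl in h1.
have h3 : dotp (grad F (x + c *: v)) v - dotp (grad F x) v <=
   L * enorm v ^+ 2 * c.
  apply: (le_trans h1); rewrite expr2 (mulrA L) mulrAC.
  rewrite ler_wpM2r ?enorm_ge0//; apply: (le_trans h2).
  by rewrite mulrA (mulrAC L).
lra.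
Qed.

(** The gradient step [- L^-1 *: grad F x] cannot descend below [Fstar]. *)
Lemma grad_sqr_le Fstar x : 0 < L -> (forall y, Fstar <= F y) ->
  enorm (grad F x) ^+ 2 <= 2 * L * (F x - Fstar).
Proof.
move=> L0 lb; have := descent_lemma x (- L^-1 *: grad F x).
rewrite dotpZr enormZ exprMn -enorm_sqr normrN ger0_norm ?invr_ge0 ?(ltW L0)//.
set g := enorm (grad F x) ^+ 2.
have -> : - L^-1 * g = - (g / L) by rewrite mulNr mulrC.
have -> : L / 2 * (L^-1 ^+ 2 * g) = (g / L) / 2.
  by field; rewrite gt_eqF.
move=> h; have : g / L / 2 <= F x - Fstar.
  by have := lb (x + - L^-1 *: grad F x); lra.
have L20 : 0 <= 2 * L by rewrite mulr_ge0// ltW.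
move=> /(ler_wpM2l L20); apply: le_trans.
by rewrite le_eqVlt; apply/orP; left; apply/eqP; field; rewrite gt_eqF.
Qed.

(** Moving along [g] instead of the gradient costs the error twice: once in the inner product with
    the unit vector, once in replacing the norm of [g] by that of the gradient. *)
Lemma normalized_step x g (gamma : R) : 0 <= gamma -> 0 <= L ->
  F (x - gamma *: normalize g) <= F x - gamma * enorm (grad F x)
    + 2 * gamma * enorm (g - grad F x) + L / 2 * gamma ^+ 2.
Proof.
move=> ga0 L0; have := descent_lemma x (- (gamma *: normalize g)).
rewrite -scaleNr dotpZr enormZ exprMn normrN (ger0_norm ga0) => h.
have n1 := enorm_normalize g; have n0 := enorm_ge0 (normalize g).
have h2 : L / 2 * (gamma ^+ 2 * enorm (normalize g) ^+ 2) <=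
    L / 2 * gamma ^+ 2.
  rewrite ler_wpM2l ?divr_ge0//; by rewrite ler_piMr ?sqr_ge0// expr_le1.
have h3 := cauchy_schwarz (g - grad F x) (normalize g).
rewrite dotpDl dotpNl dotp_normalize in h3.
have h4 : enorm (grad F x) <= enorm g + enorm (g - grad F x).
  have := ler_enormD g (grad F x - g); rewrite [g + _]addrC subrK.
  by rewrite (enormB (grad F x)).
have h5 : enorm (g - grad F x) * enorm (normalize g) <= enorm (g - grad F x).
  by rewrite ler_piMr ?enorm_ge0.
have h6 : enorm (grad F x) - 2 * enorm (g - grad F x) <=
    dotp (grad F x) (normalize g) by lra.
have := ler_wpM2l ga0 h6; lra.
Qed.

(** Pairing with a fixed [u] reduces the gradient along a line to a real function of one variable,
    the form that the Lipschitz arguments below require. *)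
Lemma is_derive_grad_line u x v (t : R) :
  (forall y, differentiable (grad F) y) ->
  is_derive t 1 (fun s : R => dotp (grad F (x + s *: v)) u)
    (dotp (v *m hess F (x + t *: v)) u).
Proof.
move=> dg; have h := is_derive_line (v := v) (dg (x + t *: v)).
rewrite deriveEjacobian// in h.
pose D := v *m hess F (x + t *: v).
have /derivable_mxP dj := @ex_derive _ _ _ _ _ _ _ h.
have hj (j : 'I_d) : is_derive t 1
    (fun s : R => u 0 j * grad F (x + s *: v) 0 j) (u 0 j * D 0 j).
  apply: (is_deriveZ (f := fun s : R => grad F (x + s *: v) 0 j)).
  apply: DeriveDef; first exact: dj.
  have := derive_mx (@ex_derive _ _ _ _ _ _ _ h).
  by rewrite derive_val => /matrixP/(_ 0 j) E; rewrite /D E mxE.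
have := is_derive_sum hj; rewrite -/D => hs.
rewrite (_ : (fun s => _) =
  \sum_(j < d) (fun s : R => u 0 j * grad F (x + s *: v) 0 j)).
  rewrite (_ : dotp _ _ = \sum_(j < d) u 0 j * D 0 j) //.
  by apply: eq_bigr => j _; rewrite mulrC.
apply/funext => s; rewrite fct_sumE; apply: eq_bigr => j _; exact: mulrC.
Qed.

Lemma measurable_grad j : (forall y, differentiable (grad F) y) ->
  measurable_fun setT (fun y : borel_rV R d => grad F y 0 j).
Proof.
move=> dg; apply: continuous_borel_rV => y.
apply: (@continuous_comp _ _ _ (grad F) (fun z : 'rV[R]_d => z 0 j)).
  exact: differentiable_continuous.
exact: coord_continuous.
Qed.

End directional_derivatives.

(** * Integrating a bounded, possibly discontinuous derivative *)

Lemma bounded_integrable {R : realType} {dT : measure_display}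
    {T : measurableType dT} (P : probability T R) (f : T -> R) (M : R) :
  measurable_fun setT f -> (forall x, `|f x| <= M) ->
  P.-integrable setT (EFin \o f).
Proof.
move=> mf fM; apply: (@le_integrable _ _ _ P setT measurableT _ (fun=> M%:E)).
- exact/measurable_EFinP.
- by move=> x _ /=; rewrite lee_fin (le_trans (fM x))// ler_norm.
exact: finite_measure_integrable_cst.
Qed.

(* [dpsi] need not be continuous: the difference quotients of [psi] are
   integrated instead, and converge boundedly to [dpsi]. *)
Section lipschitz_ftc.
Context {R : realType}.
Variables (psi dpsi : R -> R) (M : R).
Hypothesis dpsiP : forall t : R, is_derive t 1 psi (dpsi t).
Hypothesis lip : forall s t, `|psi s - psi t| <= M * `|s - t|.

Let quot (f : R -> R) (n : nat) (t : R) : R :=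
  n.+1%:R * (f (t + n.+1%:R^-1) - f t).

Let quot_cvg (f df : R -> R) (t : R) : is_derive t 1 f (df t) ->
  quot f n t @[n --> \oo] --> df t.
Proof.
move=> [/cvg_ex[l fl] fE].
have -> : df t = l by rewrite -fE; apply/cvg_lim => //.
have /cvgr_dnbhsP/(_ (fun n => n.+1%:R^-1)) h := fl.
rewrite (_ : (fun n => quot f n t) = (fun n => (n.+1%:R^-1)^-1 *:
    ((f \o shift t) (n.+1%:R^-1 *: (1 : R)) - f t))).
  apply: h; split => [n|]; first by rewrite invr_neq0.
  exact: cvg_harmonic.
apply/funext => n; rewrite /quot invrK; congr (_ * (f _ - _)).
by rewrite [_ *: 1]mulr1 addrC.
Qed.

Let psi_continuous : continuous psi.
Proof.
move=> t; apply: differentiable_continuous.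
by apply/derivable1_diffP; have [] := dpsiP t.
Qed.

Let quot_bound n t : `|quot psi n t| <= M.
Proof.
rewrite /quot normrM ger0_norm//.
have := lip (t + n.+1%:R^-1) t; rewrite addrAC subrr add0r.
have h0 : 0 <= n.+1%:R^-1 :> R by rewrite invr_ge0.
rewrite (ger0_norm h0) => h.
by rewrite mulrC -ler_pdivlMr// ltr0n.
Qed.

Lemma lipschitz_derive_bound t : `|dpsi t| <= M.
Proof.
have h : `|quot psi n t| @[n --> \oo] --> `|dpsi t|.
  by apply: cvg_norm; exact: quot_cvg.
rewrite -(cvg_lim _ h)//.
apply: limr_le; first by apply/cvg_ex; exists `|dpsi t|.
by apply: nearW => n; exact: quot_bound.
Qed.

Let quot_continuous n : continuous (quot psi n).
Proof.
move=> t; apply: cvgM; first exact: cvg_cst.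
apply: cvgB; last exact: psi_continuous.
have hc : continuous (psi \o (fun s => s + n.+1%:R^-1)).
  move=> s; apply: continuous_comp; last exact: psi_continuous.
  by apply: cvgD; [exact: cvg_id|exact: cvg_cst].
exact: hc.
Qed.

Lemma lipschitz_derive_measurable : measurable_fun setT dpsi.
Proof.
apply: (@measurable_fun_cvg _ _ _ _ (quot psi)) => [n|t _].
  exact: continuous_measurable_fun.
exact: quot_cvg.
Qed.

(** Starting at -1 keeps 0 interior, so that [Psi] has two-sided derivatives at 0 and 1. *)
Let Psi (x : R) : R := (\int[lebesgue_measure]_(t in `[(-1)%R, x]) psi t)%R.

Let PsiP (x : R) : -1 < x -> is_derive x 1 Psi (psi x).
Proof.
move=> x1.
have [] := @continuous_FTC1_closed R psi (-1) x (x + 1).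
- by rewrite ltrDl.
- apply: continuous_compact_integrable; first exact: segment_compact.
  exact: continuous_subspaceT.
- exact: x1.
- exact: psi_continuous.
by move=> h1 h2; apply: DeriveDef => //; rewrite -derive1E.
Qed.

(** Difference quotients commute with differentiation: [quot Psi n] is a primitive of the continuous
    [quot psi n], and its values at 1 and 0 tend to those of [psi]. *)
Let integral_quot n : (\int[lebesgue_measure]_(t in `[0%R, 1%R]) (quot psi n t)%:E)%E =
  (quot Psi n 1 - quot Psi n 0)%:E.
Proof.
have dq (x : R) : -1 < x -> is_derive x 1 (quot Psi n) (quot psi n x).
  move=> x1; have h1 := PsiP x1.
  have x2 : -1 < x + n.+1%:R^-1.
    by rewrite (lt_le_trans x1)// lerDl invr_ge0.
  have [h2 h2E] := PsiP x2.
  have h3 : is_derive x 1 (fun s => Psi (s + n.+1%:R^-1))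
      (psi (x + n.+1%:R^-1)).
    rewrite -h2E.
    have E : (fun h : R => h^-1 *: (((fun s => Psi (s + n.+1%:R^-1)) \o shift x)
       (h *: (1 : R)) - Psi (x + n.+1%:R^-1))) =
       (fun h : R => h^-1 *: ((Psi \o shift (x + n.+1%:R^-1)) (h *: (1 : R))
         - Psi (x + n.+1%:R^-1))).
      by apply/funext => h /=; rewrite /shift /= addrA.
    by apply: DeriveDef; rewrite /derivable /derive E.
  exact: (is_deriveZ n.+1%:R (is_deriveB h3 h1)).
have lt0 : -1 < 0 :> R by lra.
have lt1 : -1 < 1 :> R by lra.
rewrite (@continuous_FTC2 _ (quot psi n) (quot Psi n))//.
- by apply: continuous_subspaceT; exact: quot_continuous.
- split.
  + move=> x; rewrite in_itv/= => /andP[x0 _].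
    by have [] := dq x (lt_trans lt0 x0).
  + apply: cvg_at_right_filter; apply: differentiable_continuous.
    by apply/derivable1_diffP; have [] := dq 0 lt0.
  + apply: cvg_at_left_filter; apply: differentiable_continuous.
    by apply/derivable1_diffP; have [] := dq 1 lt1.
- move=> x; rewrite in_itv/= => /andP[x0 _].
  rewrite derive1E.
  by have [_ ->] := dq x (lt_trans lt0 x0).
Qed.

Let integral_dpsi :
  (\int[lebesgue_measure]_(t in `[0%R, 1%R]) (dpsi t)%:E = (psi 1 - psi 0)%:E)%E.
Proof.
have [] := @dominated_convergence _ (measurableTypeR R) R lebesgue_measure
  `[0%R, 1%R]%classic (measurable_itv _) (fun n t => (quot psi n t)%:E)
  (fun t => (dpsi t)%:E) (fun=> M%:E).
- move=> n; apply/measurable_EFinP; apply: measurable_funTS.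
  exact: continuous_measurable_fun.
- apply/measurable_EFinP; apply: measurable_funTS.
  exact: lipschitz_derive_measurable.
- apply: aeW => t _; apply: cvg_EFin; first exact: nearW.
  exact: quot_cvg.
- apply: continuous_compact_integrable; first exact: segment_compact.
  by apply: continuous_subspaceT => t; exact: cvg_cst.
- by apply: aeW => t n _; rewrite lee_fin quot_bound.
move=> _ _; set g := (X in X @ _ --> _).
have -> : g = (fun n => (quot Psi n 1 - quot Psi n 0)%:E).
  by apply/funext => n; exact: integral_quot.
move=> h; apply: cvg_unique h _ => //.
have lt0 : -1 < 0 :> R by lra.
have lt1 : -1 < 1 :> R by lra.
apply: cvg_EFin; first exact: nearW.
by apply: cvgB; apply: quot_cvg; exact: PsiP.
Qed.

Lemma lipschitz_ftc : (\int[uniform_prob (@ltr01 R)]_t (dpsi t)%:E)%E =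
  (psi 1 - psi 0)%:E.
Proof.
(* The passage from the uniform law to Lebesgue measure is made on a nonnegative integrand, hence
   the shift by the bound [M], subtracted again at the end. *)
have mpsi : measurable_fun setT (fun t => dpsi t + M).
  by apply: measurable_funD => //; exact: lipschitz_derive_measurable.
have h := @integral_uniform R 0 1 ltr01 (fun t => (dpsi t + M)%:E) _ _.
have {h} := h (iffRL (measurable_EFinP _ _) mpsi) _.
rewrite subr0 invr1 mul1e.
have iU : (uniform_prob (@ltr01 R)).-integrable setT (EFin \o dpsi).
  apply: (@bounded_integrable _ _ (measurableTypeR R) (uniform_prob (@ltr01 R))
    dpsi _ _ lipschitz_derive_bound).
  exact: lipschitz_derive_measurable.
have iL : lebesgue_measure.-integrable `[0%R, 1%R] (EFin \o dpsi).
  apply: (@le_integrable _ _ _ _ _ _ _ (fun=> M%:E)) => //.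
  - apply/measurable_EFinP; apply: measurable_funTS.
    exact: lipschitz_derive_measurable.
  - move=> x _ /=; rewrite lee_fin.
    by rewrite (le_trans (lipschitz_derive_bound x))// ler_norm.
  apply: continuous_compact_integrable; first exact: segment_compact.
  by apply: continuous_subspaceT => t; exact: cvg_cst.
have iM : lebesgue_measure.-integrable `[0%R, 1%R] (fun=> M%:E).
  apply: continuous_compact_integrable; first exact: segment_compact.
  by apply: continuous_subspaceT => t; exact: cvg_cst.
under eq_integral do rewrite EFinD.
under [in RHS]eq_integral do rewrite EFinD.
rewrite integralD//; last exact: finite_measure_integrable_cst.
rewrite integralD// integral_dpsi !integral_cst//=.
rewrite probability_setT lebesgue_measure_itv/= lte_fin ltr01 oppr0 addr0 mule1.
move=> h; have {h} := h _; set I1 := integral _ _ _ => h.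
have /h : forall x, (0 <= (dpsi x + M)%:E)%E.
  move=> x; rewrite lee_fin; have := lipschitz_derive_bound x.
  by rewrite ler_norml; lra.
by move=> /(congr1 (fun z => z - M%:E)%E); rewrite !addeK.
Qed.

End lipschitz_ftc.

(** * Noise of the stochastic oracles *)

Section integrated_step.
Context {R : realType} {d : nat} {dT : measure_display} {T : measurableType dT}.
Variables (P : probability T R) (X : T -> 'rV[R]_d) (mu : 'rV[R]_d).
Hypothesis mX : measurable_coord X.
Hypothesis EX : forall j, P.-integrable setT (EFin \o (fun t => X t 0 j)) /\
  (\int[P]_t (X t 0 j)%:E = (mu 0 j)%:E)%E.

Let term (w : 'rV[R]_d) j t : \bar R := ((w 0 j)%:E * ((X t 0 j)%:E - (mu 0 j)%:E))%E.

Let termE (w : 'rV[R]_d) t :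
  (dotp w (X t - mu))%:E = (\sum_j term w j t)%E.
Proof.
rewrite /dotp -sumEFin; apply: eq_bigr => j _.
by rewrite /term -EFinB -EFinM !mxE.
Qed.

Let integrable_diff j :
  P.-integrable setT (fun t => ((X t 0 j)%:E - (mu 0 j)%:E)%E).
Proof.
apply: integrableB => //; first exact: (EX j).1.
exact: finite_measure_integrable_cst.
Qed.

Lemma integrable_dotp_centered (w : 'rV[R]_d) :
  P.-integrable setT (fun t => (dotp w (X t - mu))%:E).
Proof.
rewrite (_ : (fun t => _) = (fun t => \sum_j term w j t)%E).
  by apply: integrable_sum => // j _; exact: integrableZl.
by apply/funext => t; exact: termE.
Qed.

Lemma integral_dotp_centered (w : 'rV[R]_d) :
  (\int[P]_t (dotp w (X t - mu))%:E = 0)%E.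
Proof.
under eq_integral do rewrite termE.
rewrite integral_sum//; last by move=> j; exact: integrableZl.
rewrite big1// => j _; rewrite integralZl// integralB//; last 2 first.
- exact: (EX j).1.
- exact: finite_measure_integrable_cst.
by rewrite (EX j).2 integral_cst//= probability_setT mule1 subee// mule0.
Qed.

(** In [expR_pot_step] the linear term integrates to zero because [X] is unbiased; what remains is
    at most [1 + 16 * t], below [expR (16 * t)]. *)
Lemma integral_pot_step (p l b t : R) (m : 'rV[R]_d) :
  1 <= p <= 2 -> 0 < l -> 0 <= b -> b * l <= 1 -> enorm mu <= l ->
  (\int[P]_w ((enorm (X w - mu) / l) `^ p)%:E <= (16 * t)%:E)%E ->
  (\int[P]_w (expR (16^-1 * pot (m + b *: (clip (X w) (2 * l) - mu))))%:E <=
   (expR (16^-1 * pot m + 16 * t))%:E)%E.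
Proof.
move=> p12 l0 b0 bl mul Dt.
set v := (16^-1 * b / pot m) *: m.
set D := fun w => (enorm (X w - mu) / l) `^ p.
have mdiff : measurable_coord (fun w => X w - mu).
  by apply: measurable_coordB => //; exact: measurable_coord_cst.
have mD : measurable_fun setT D.
  apply: (measurableT_comp (measurable_powR p)).
  by apply: measurable_funM => //; exact: measurable_enorm.
have iD : P.-integrable setT (EFin \o D).
  apply/integrableP; split; first exact/measurable_EFinP.
  rewrite (le_lt_trans _ (ltry (16 * t)))//.
  apply: le_trans Dt; rewrite le_eqVlt; apply/orP; left; apply/eqP.
  by apply: eq_integral => w _ /=; rewrite ger0_norm ?powR_ge0.
have i1 := integrable_dotp_centered v.
have ic : P.-integrable setT (cst 1%E) by exact: finite_measure_integrable_cst.
pose E := expR (16^-1 * pot m).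
pose rhs w := (1 + (dotp v (X w - mu))%:E + (D w)%:E)%E.
have irhs : P.-integrable setT rhs.
  by apply: integrableD => //; exact: integrableD.
apply: (@le_trans _ _ (\int[P]_w (E%:E * rhs w)%E)%E).
  apply: ge0_le_integral => //.
  - apply/measurable_EFinP; apply: (measurableT_comp (@measurable_expR R)).
    apply: measurable_funM => //; apply: measurable_pot.
    apply: measurable_coordD; first exact: measurable_coord_cst.
    apply: measurable_coordZ => //; apply: measurable_coordB.
      exact: measurable_coord_clip.
    exact: measurable_coord_cst.
  - by apply: (measurable_int P); exact: integrableZl.
  - move=> w _; rewrite /rhs -!EFinD -EFinM lee_fin.
    exact: expR_pot_step.
rewrite integralZl//.
have -> : (\int[P]_w rhs w = 1 + \int[P]_w (D w)%:E)%E.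
  rewrite integralD//; last exact: integrableD.
  rewrite integralD// integral_dotp_centered.
  by rewrite integral_cst//= probability_setT mule1 adde0.
apply: (@le_trans _ _ (E%:E * (1 + (16 * t)%:E))%E).
  by rewrite lee_pmul2l// ?lte_fin ?expR_gt0// leeD2l.
by rewrite -EFinD -EFinM lee_fin expRD ler_pM2l ?expR_gt0// expR_ge1Dx.
Qed.

End integrated_step.

(** Both integrals are suprema over the simple functions below. The form without measurability is
    the one needed for [opnorm], itself a supremum over a ball. *)
Lemma le_integral_ge0 {R : realType} {dT : measure_display}
    {T : measurableType dT} (mu : {measure set T -> \bar R}) (f g : T -> \bar R) :
  (forall x, 0 <= f x)%E -> (forall x, f x <= g x)%E ->
  (\int[mu]_x f x <= \int[mu]_x g x)%E.
Proof.
move=> f0 fg; have g0 x : (0 <= g x)%E by exact: le_trans (fg x).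
rewrite !ge0_integralTE//; apply: le_ereal_sup => _ [h /= hf <-].
by exists h => //= x; exact: le_trans (fg x).
Qed.

Lemma powR_le_sum {R : realType} (p a b : R) : 1 <= p <= 2 ->
  0 <= a -> 0 <= b -> (a + b) `^ p <= 4 * (a `^ p + b `^ p).
Proof.
move=> /andP[p1 p2] a0 b0; have p0 : 0 <= p by lra.
have two : (2 : R) `^ p <= 4.
  apply: (@le_trans _ _ ((2 : R) `^ 2)).
    by apply: ler_powR => //; rewrite ler1n.
  by rewrite (_ : (2 : R) `^ 2 = 2 ^+ 2) ?powR_mulrn//; lra.
have h (x y : R) : 0 <= x -> x <= y -> (x + y) `^ p <= 4 * y `^ p.
  move=> x0 xy; have y0 : 0 <= y by exact: le_trans xy.
  apply: (@le_trans _ _ ((2 * y) `^ p)).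
    by rewrite ge0_ler_powR// ?nnegrE; lra.
  by rewrite powRM// ler_wpM2r ?powR_ge0.
have := powR_ge0 a p; have := powR_ge0 b p.
have [ab|ba] := leP a b; first by have := h _ _ a0 ab; lra.
by have := h _ _ b0 (ltW ba); rewrite addrC; lra.
Qed.

(** One factor is split off each power, and the remaining power, of exponent [p - 1], is
    monotone. *)
Lemma powR_superadd {R : realType} (p a b : R) : 1 <= p ->
  0 <= a -> 0 <= b -> a `^ p + b `^ p <= (a + b) `^ p.
Proof.
move=> p1 a0 b0; have p0 : 0 < p by lra.
have q0 : 0 <= p - 1 by lra.
rewrite -(mulr_powRB1 a0 p0) -(mulr_powRB1 b0 p0).
rewrite -(mulr_powRB1 (addr_ge0 a0 b0) p0) mulrDl.
by apply: lerD; rewrite ler_wpM2l// ge0_ler_powR// ?nnegrE ?addr_ge0//; lra.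
Qed.

Lemma ler1D_powR {R : realType} (p a : R) : 1 <= p -> 0 <= a -> a <= 1 + a `^ p.
Proof.
move=> p1 a0; have := powR_ge0 a p; have [a1|a1] := leP a 1; first by lra.
by have := le1r_powR (ltW a1) p1; lra.
Qed.

(** * Moments of the Hessian-vector product at a uniform point of the segment *)

Section hessian_noise.
Context {R : realType} {d : nat} {dXi : measure_display}
  {Xi : measurableType dXi}.
Variables (D : probability Xi R) (p L sigma_h : R) (F : 'rV[R]_d -> R).
Variables (hessf : 'rV[R]_d -> Xi -> 'M[R]_d) (x xp : 'rV[R]_d).
Hypothesis p12 : 1 <= p <= 2.
Hypothesis L0 : 0 < L.
Hypothesis sh0 : 0 < sigma_h.
Hypothesis smoothF : smooth L F.
Hypothesis dgF : forall y, differentiable (grad F) y.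
Hypothesis bcm : bcm_hessian D p sigma_h F hessf.

Let v := x - xp.
Let xhat (q : R) := q *: x + (1 - q) *: xp.

Let xhatE q : xhat q = xp + q *: v.
Proof.
by rewrite /xhat /v scalerBl scale1r scalerBr [RHS]addrC addrA addrAC -addrA.
Qed.

Notation TR := (measurableTypeR R).
Let U : probability TR R := uniform_prob (@ltr01 R).

Definition hess_product (z : TR * Xi) : 'rV[R]_d := v *m hessf (xhat z.1) z.2.

Let mean (q : TR) : 'rV[R]_d := v *m hess F (xhat q).

Let psi_lip (u : 'rV[R]_d) (s t : R) :
  `|dotp (grad F (xp + s *: v)) u - dotp (grad F (xp + t *: v)) u| <=
  L * enorm v * enorm u * `|s - t|.
Proof.
rewrite -dotpNl -dotpDl; apply: (le_trans (cauchy_schwarz_norm _ _)).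
have := smoothF.2 (xp + s *: v) (xp + t *: v).
rewrite opprD addrACA subrr add0r -scalerBl enormZ => h.
apply: (le_trans (ler_wpM2r (enorm_ge0 u) h)).
by rewrite le_eqVlt; apply/orP; left; apply/eqP; ring.
Qed.

Let psi_derive u (t : R) : is_derive t 1
  (fun s : R => dotp (grad F (xp + s *: v)) u) (dotp (mean t) u).
Proof. by rewrite /mean xhatE; exact: is_derive_grad_line. Qed.

Let dotp_delta (w : 'rV[R]_d) j : dotp w (delta_mx 0 j) = w 0 j.
Proof.
rewrite /dotp (bigD1 j)//= big1 ?addr0 => [|i ij]; rewrite mxE eqxx/=.
  by rewrite eqxx mulr1.
by rewrite (negbTE ij) mulr0.
Qed.

(** The derivative along the segment is tested against its own value: with [u] equal to [mean q],
    the Lipschitz bound reads [enorm (mean q) ^+ 2 <= L * enorm v * enorm (mean q)]. *)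
Let mean_bound q : enorm (mean q) <= L * enorm v.
Proof.
have [->|m0] := eqVneq (mean q) 0; first by rewrite enorm0 mulr_ge0 ?enorm_ge0// ltW.
have := lipschitz_derive_bound (psi_derive (mean q)) (psi_lip (mean q)) q.
rewrite -enorm_sqr ger0_norm ?sqr_ge0// expr2.
by rewrite ler_pM2r// enorm_gt0.
Qed.

(** [hess F] is known only as a derivative; its product with [v] is measurable as a pointwise limit
    of difference quotients. *)
Let measurable_mean : measurable_coord mean.
Proof.
move=> j; rewrite (_ : (fun t => _) = (fun t : TR => dotp (mean t) (delta_mx 0 j))).
  exact: (lipschitz_derive_measurable (psi_derive _)).
by apply/funext => t; rewrite dotp_delta.
Qed.

Let integral_mean j : (\int[U]_q (mean q 0 j)%:E =
  ((grad F x - grad F xp) 0 j)%:E)%E.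
Proof.
rewrite (eq_integral (fun q : TR => (dotp (mean q) (delta_mx 0 j))%:E)%E); last first.
  by move=> q _; rewrite dotp_delta.
rewrite (lipschitz_ftc (psi_derive _) (psi_lip _)).
rewrite !dotp_delta scale1r scale0r addr0.
have -> : xp + v = x by rewrite addrC subrK.
by rewrite !mxE.
Qed.

Lemma measurable_hess_product : measurable_coord hess_product.
Proof.
have [mh _ _] := bcm.
apply: measurable_coord_mulmx; first exact: measurable_coord_cst.
move=> i j.
apply: (@measurableT_comp _ _ _ _ _ _ _ setT
  (fun z : TR * Xi => (xhat z.1 : borel_rV R d, z.2)) (mh i j)).
apply: measurable_fun_pair => //; apply: measurable_borel_rV.
apply: measurable_coordD; apply: measurable_coordZ;
  try exact: measurable_coord_cst.
  exact: measurable_fst.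
by apply: measurable_funB => //; exact: measurable_fst.
Qed.

Let dev (z : TR * Xi) : R := enorm (hess_product z - mean z.1).

Let measurable_dev : measurable_fun setT (fun z => dev z `^ p).
Proof.
apply: (measurableT_comp (measurable_powR p)); apply: measurable_enorm.
apply: measurable_coordB; first exact: measurable_hess_product.
by move=> j; apply: (measurableT_comp (measurable_mean j)); exact: measurable_fst.
Qed.

Let dev_moment (q : TR) :
  (\int[D]_xi (dev (q, xi) `^ p)%:E <= ((enorm v * sigma_h) `^ p)%:E)%E.
Proof.
have mdev : measurable_fun setT (fun xi => dev (q, xi) `^ p).
  by apply: (measurableT_comp measurable_dev); exact: pair1_measurable.
have p0 : p != 0 by rewrite gt_eqF//; move: p12; lra.
have devE xi : dev (q, xi) = enorm (v *m (hessf (xhat q) xi - hess F (xhat q))).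
  by rewrite /dev /hess_product /mean mulmxBr.
(* The case [v = 0] is set apart because the general one divides by a power of its norm; it does
   occur, since x_1 = x_0. *)
have [v0|v0] := eqVneq v 0.
  rewrite integral0_eq ?lee_fin ?powR_ge0// => xi _.
  by rewrite devE v0 mul0mx enorm0 powR0.
rewrite -enorm_gt0 in v0.
have [_ _ /(_ (xhat q))] := bcm; rewrite unlock => h.
rewrite powRM ?enorm_ge0 ?(ltW sh0)// EFinM muleC -lee_pdivrMr ?powR_gt0//.
apply: le_trans h; rewrite muleC -ge0_integralZl//; last 3 first.
- exact/measurable_EFinP.
- by move=> xi _; rewrite lee_fin powR_ge0.
- by rewrite lee_fin invr_ge0 powR_ge0.
apply: le_integral_ge0 => xi.
  by rewrite -EFinM lee_fin mulr_ge0 ?invr_ge0 ?powR_ge0.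
rewrite -EFinM lee_fin mulrC ler_pdivrMr ?powR_gt0// mulrC -powRM ?enorm_ge0 ?opnorm_ge0//.
by rewrite ge0_ler_powR ?nnegrE ?mulr_ge0 ?enorm_ge0 ?opnorm_ge0// ?devE ?enorm_mulmx//; move: p12; lra.
Qed.

Let UD : probability (TR * Xi)%type R := (U \x D)%E.

Let integral_dev :
  (\int[UD]_z (dev z `^ p)%:E <= ((enorm v * sigma_h) `^ p)%:E)%E.
Proof.
rewrite fubini_tonelli1//; last 2 first.
- exact/measurable_EFinP.
- by move=> z; rewrite lee_fin powR_ge0.
apply: (@le_trans _ _ (\int[U]_q ((enorm v * sigma_h) `^ p)%:E)%E).
  apply: le_integral_ge0 => q; last exact: dev_moment.
  by apply: integral_ge0 => xi _; rewrite lee_fin powR_ge0.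
by rewrite integral_cst//= probability_setT mule1.
Qed.

Let integrable_dev : UD.-integrable setT (fun z => (dev z `^ p)%:E).
Proof.
apply/integrableP; split; first exact/measurable_EFinP.
apply: (le_lt_trans _ (ltry ((enorm v * sigma_h) `^ p))).
apply: le_trans integral_dev; apply: le_integral_ge0 => z //.
by rewrite gee0_abs ?lee_fin ?powR_ge0.
Qed.

Lemma integrable_hess_product j :
  UD.-integrable setT (fun z => (hess_product z 0 j)%:E).
Proof.
have ib : UD.-integrable setT
    (fun z => ((1 + L * enorm v)%:E + (dev z `^ p)%:E)%E).
  by apply: integrableD => //; exact: finite_measure_integrable_cst.
apply: le_integrable ib => //.
  by apply/measurable_EFinP; exact: measurable_hess_product.
move=> z _; rewrite -EFinD /= lee_fin.
have /andP[p1 _] := p12.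
have h1 := ler1D_powR p1 (enorm_ge0 (hess_product z - mean z.1)).
have h2 := ler_enormD (hess_product z - mean z.1) (mean z.1).
rewrite subrK in h2.
have := mean_bound z.1; have := coord_le_enorm (hess_product z) j.
rewrite -/(dev z) in h1 h2 *.
by have := ler_norm (1 + L * enorm v + dev z `^ p); lra.
Qed.

Lemma integral_hess_product j : (\int[UD]_z (hess_product z 0 j)%:E =
  ((grad F x - grad F xp) 0 j)%:E)%E.
Proof.
rewrite -integral12_prod_meas1; last exact: integrable_hess_product.
rewrite -integral_mean; apply: eq_integral => q _.
have [_ /(_ (xhat q)) h _] := bcm.
transitivity (\int[D]_xi \sum_i ((v 0 i)%:E * (hessf (xhat q) xi i j)%:E))%E.
  apply: eq_integral => xi _; rewrite /hess_product mxE -sumEFin.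
  by apply: eq_bigr => i _; rewrite EFinM.
rewrite integral_sum//; last by move=> i; apply: integrableZl => //; exact: (h i j).1.
rewrite /mean mxE -sumEFin; apply: eq_bigr => i _.
rewrite integralZl//; last exact: (h i j).1.
by have [_] := h i j; rewrite unlock EFinM => ->.
Qed.

(** Two deviations add up: the Hessian noise at the sampled point, and the randomness of that point,
    at most [2 * (L * enorm v)] by smoothness. [powR_le_sum] separates them, with constants 4 and 4
    times 2^p, at most 16; [powR_superadd] recombines them into a power of
    [gamma * (L + sigma_h)]. *)
Lemma hess_product_moment (gamma l t : R) : enorm v <= gamma -> 0 < l ->
  (gamma * (L + sigma_h)) `^ p <= t * l `^ p ->
  (\int[UD]_z
     ((enorm (hess_product z - (grad F x - grad F xp)) / l) `^ p)%:E <=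
   (16 * t)%:E)%E.
Proof.
move=> vg l0 tl; have /andP[p1 p2] := p12; have p0 : 0 <= p by lra.
have v0 := enorm_ge0 v; have g0 : 0 <= gamma by exact: le_trans vg.
have Lv : 0 <= L * enorm v by rewrite mulr_ge0// ltW.
pose c := 16 * (L * enorm v) `^ p.
pose k := (l `^ p)^-1; have k0 : 0 < k by rewrite invr_gt0 powR_gt0.
have pt z : (enorm (hess_product z - (grad F x - grad F xp)) / l) `^ p <=
    k * (4 * dev z `^ p + c).
  rewrite powRM ?enorm_ge0 ?invr_ge0 ?(ltW l0)//.
  rewrite (_ : l^-1 `^ p = k); last first.
    by rewrite -powR_inv1 ?ltW// powRAC powR_inv1// powR_ge0.
  rewrite [leLHS]mulrC ler_pM2l//.
  have h1 : enorm (hess_product z - (grad F x - grad F xp)) <=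
      dev z + 2 * (L * enorm v).
    have E : hess_product z - (grad F x - grad F xp) =
      (hess_product z - mean z.1) + (mean z.1 - (grad F x - grad F xp)).
      by rewrite addrA subrK.
    rewrite E; apply: (le_trans (ler_enormD _ _)); rewrite lerD2l.
    apply: (le_trans (ler_enormB _ _)).
    by have := smoothF.2 x xp; have := mean_bound z.1; rewrite -/v; lra.
  apply: (@le_trans _ _ ((dev z + 2 * (L * enorm v)) `^ p)).
    by rewrite ge0_ler_powR// ?nnegrE ?enorm_ge0// addr_ge0 ?enorm_ge0//; lra.
  have dz : 0 <= dev z by exact: enorm_ge0.
  apply: (le_trans (powR_le_sum p12 dz _)); first by lra.
  rewrite mulrDr lerD2l /c powRM//.
  have : (2 : R) `^ p <= 4.
    apply: (@le_trans _ _ ((2 : R) `^ 2)).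
      by apply: ler_powR => //; rewrite ler1n.
    by rewrite (_ : (2 : R) `^ 2 = 2 ^+ 2) ?powR_mulrn//; lra.
  by have := powR_ge0 (L * enorm v) p; nra.
apply: (@le_trans _ _ (\int[UD]_z (k%:E * (4%:E * (dev z `^ p)%:E + c%:E)))%E).
  apply: le_integral_ge0 => z; first by rewrite lee_fin powR_ge0.
  by rewrite -!EFinM lee_fin.
rewrite integralZl//; last first.
  by apply: integrableD => //; [exact: integrableZl|
    exact: finite_measure_integrable_cst].
rewrite integralD//; [|exact: integrableZl|exact: finite_measure_integrable_cst].
rewrite integralZl// integral_cst//= probability_setT mule1.
apply: (@le_trans _ _ (k%:E * (4%:E * ((enorm v * sigma_h) `^ p)%:E + c%:E))%E).
  by rewrite lee_pmul2l// leeD2r// lee_pmul2l.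
rewrite -!EFinM lee_fin /k mulrC ler_pdivrMr ?powR_gt0//.
rewrite -mulrA; apply: (le_trans _ (ler_wpM2l _ tl)) => //.
have sh := ltW sh0.
have h1 : (enorm v * sigma_h) `^ p <= (gamma * sigma_h) `^ p.
  by rewrite ge0_ler_powR// ?nnegrE ?mulr_ge0// ler_wpM2r.
have h2 : (L * enorm v) `^ p <= (gamma * L) `^ p.
  by rewrite mulrC ge0_ler_powR// ?nnegrE ?mulr_ge0 ?(ltW L0)// ler_wpM2r// ltW.
have := powR_superadd p1 (mulr_ge0 g0 (ltW L0)) (mulr_ge0 g0 sh).
rewrite -mulrDr /c; have := powR_ge0 (gamma * sigma_h) p; lra.
Qed.

End hessian_noise.

Section gradient_noise.
Context {R : realType} {d : nat} {dXi : measure_display}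
  {Xi : measurableType dXi}.
Variables (D : probability Xi R) (p sigma : R) (F : 'rV[R]_d -> R).
Variables (gradf : 'rV[R]_d -> Xi -> 'rV[R]_d) (x : 'rV[R]_d).
Hypothesis bcm : bcm_gradient D p sigma F gradf.

Lemma measurable_stoch_grad : measurable_coord (gradf x).
Proof.
have [mg _ _] := bcm; move=> j.
apply: (@measurableT_comp _ _ _ _ _ _ _ setT
  (fun z : Xi => (x : borel_rV R d, z)) (mg j)).
exact: pair1_measurable.
Qed.

Lemma stoch_grad_moment (l t : R) : 0 < l -> sigma `^ p <= 16 * t * l `^ p ->
  (\int[D]_xi ((enorm (gradf x xi - grad F x) / l) `^ p)%:E <= (16 * t)%:E)%E.
Proof.
move=> l0 tl; have [_ _ /(_ x)] := bcm; rewrite unlock => h.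
pose k := (l `^ p)^-1; have k0 : 0 < k by rewrite invr_gt0 powR_gt0.
under eq_integral => xi _.
  rewrite powRM ?enorm_ge0 ?invr_ge0 ?(ltW l0)//.
  rewrite (_ : l^-1 `^ p = k); last first.
    by rewrite -powR_inv1 ?ltW// powRAC powR_inv1// powR_ge0.
  rewrite mulrC EFinM; over.
have mg := measurable_stoch_grad.
rewrite ge0_integralZl//; last 3 first.
- apply/measurable_EFinP; apply: (measurableT_comp (measurable_powR p)).
  by apply/measurable_enorm/measurable_coordB => //; exact: measurable_coord_cst.
- by move=> xi _; rewrite lee_fin powR_ge0.
- by rewrite lee_fin ltW.
apply: (@le_trans _ _ (k%:E * (sigma `^ p)%:E)%E).
  by rewrite lee_pmul2l.
by rewrite -EFinM lee_fin /k mulrC ler_pdivrMr ?powR_gt0.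
Qed.

End gradient_noise.

Section new_estimate.
Context {R : realType} {d : nat} {dXi : measure_display}
  {Xi : measurableType dXi}.
Variables (D : probability Xi R) (p sigma sigma_h : R) (F : 'rV[R]_d -> R).
Variables (gradf : 'rV[R]_d -> Xi -> 'rV[R]_d)
  (hessf : 'rV[R]_d -> Xi -> 'M[R]_d).
Hypothesis bcmg : bcm_gradient D p sigma F gradf.
Hypothesis bcmh : bcm_hessian D p sigma_h F hessf.
Variables (alpha lambda lambda_h : R).

Definition new_estimate (xp x g : 'rV[R]_d) (q : R) (zh z : Xi) : 'rV[R]_d :=
  (1 - alpha) *: (g + clip ((x - xp) *m hessf (q *: x + (1 - q) *: xp) zh)
                           lambda_h)
  + alpha *: clip (gradf x z) lambda.

Lemma measurable_hess_term (dT : measure_display) (T : measurableType dT)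
    (xp x : T -> 'rV[R]_d) (q : T -> R) (zh : T -> Xi) :
  measurable_coord xp -> measurable_coord x ->
  measurable_fun setT q -> measurable_fun setT zh ->
  measurable_coord (fun t =>
    (x t - xp t) *m hessf (q t *: x t + (1 - q t) *: xp t) (zh t)).
Proof.
move=> mxp mx mq mzh; have [mhf _ _] := bcmh.
apply: measurable_coord_mulmx; first exact: measurable_coordB.
move=> i j; apply: (@measurableT_comp _ _ _ _ _ _ _ setT
  (fun t : T => (q t *: x t + (1 - q t) *: xp t : borel_rV R d, zh t))
  (mhf i j)).
apply: measurable_fun_pair => //; apply: measurable_borel_rV.
apply: measurable_coordD; apply: measurable_coordZ => //.
exact: measurable_funB.
Qed.

Lemma measurable_new_estimate (dT : measure_display) (T : measurableType dT)
    (xp x g : T -> 'rV[R]_d) (q : T -> R) (zh z : T -> Xi) :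
  measurable_coord xp -> measurable_coord x -> measurable_coord g ->
  measurable_fun setT q -> measurable_fun setT zh -> measurable_fun setT z ->
  measurable_coord
    (fun t => new_estimate (xp t) (x t) (g t) (q t) (zh t) (z t)).
Proof.
move=> mxp mx mg mq mzh mz; have [mgf _ _] := bcmg.
apply: measurable_coordD; apply: measurable_coordZ => //.
  apply: measurable_coordD => //; apply: measurable_coord_clip.
  exact: measurable_hess_term.
apply: measurable_coord_clip => j; apply: (@measurableT_comp _ _ _ _ _ _ _ setT
    (fun t : T => (x t : borel_rV R d, z t)) (mgf j)).
by apply: measurable_fun_pair => //; exact: measurable_borel_rV.
Qed.

End new_estimate.

(** * Concentration of the estimation error *)

Section process.
Context {R : realType} {d : nat} {dO dXi : measure_display}
  {Omega : measurableType dO} {Xi : measurableType dXi}.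
Variables (P : probability Omega R) (D : probability Xi R).
Variables (p L sigma sigma_h : R) (F : 'rV[R]_d -> R).
Variables (gradf : 'rV[R]_d -> Xi -> 'rV[R]_d)
  (hessf : 'rV[R]_d -> Xi -> 'M[R]_d) (x0 : 'rV[R]_d).
Variables (q : nat -> {RV P >-> R}) (xi xih : nat -> {RV P >-> Xi}) (T : nat).
Variables (gamma alpha lg lh r : R).
Hypothesis p12 : 1 <= p <= 2.
Hypothesis L0 : 0 < L.
Hypothesis sh0 : 0 < sigma_h.
Hypothesis smoothF : smooth L F.
Hypothesis dgF : forall y, differentiable (grad F) y.
Hypothesis bcmg : bcm_gradient D p sigma F gradf.
Hypothesis bcmh : bcm_hessian D p sigma_h F hessf.
Hypothesis samples : nsgd_samples D q xi xih T.
Hypothesis gamma0 : 0 <= gamma.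
Hypothesis alpha01 : 0 < alpha <= 1.
Hypothesis lg0 : 0 < lg.
Hypothesis lh0 : 0 < lh.
Hypothesis r0 : 0 <= r.
Hypothesis lgP : sigma `^ p <= 16 * alpha * lg `^ p.
Hypothesis lhP : (gamma * (L + sigma_h)) `^ p <= alpha * lh `^ p.
Hypothesis lhL : L * gamma <= lh.

(** [lg] and [lh] are half the clipping levels and bound the means of what is clipped. In the unit
    [s] both noise coefficients meet the condition [b * l <= 1] of [integral_pot_step]. *)
Let s := alpha * lg + lh.

Definition run (w : Omega) (t : nat) :=
  nsgd_state gradf hessf gamma alpha (2 * lg) (2 * lh) x0
    (fun i => q i w) (fun i => xi i w) (fun i => xih i w) t.

Let xcur t w := (run w t).1.1.
Let xnext t w := (run w t).1.2.
Let est t w := (run w t).2.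

Let new t w := new_estimate gradf hessf alpha (2 * lg) (2 * lh)
  (xcur t w) (xnext t w) (est t w).

Lemma runS w t : run w t.+1 =
  let g := new t w (q t.+1 w) (xih t.+1 w) (xi t.+1 w) in
  (xnext t w, xnext t w - gamma *: normalize g, g).
Proof. by rewrite /new /xcur /xnext /est /run /=; case: nsgd_state => [[]]. Qed.

Let xcurS t w : xcur t.+1 w = xnext t w.
Proof. by rewrite /xcur runS. Qed.

Let estS t w : est t.+1 w = new t w (q t.+1 w) (xih t.+1 w) (xi t.+1 w).
Proof. by rewrite /est runS. Qed.

Let xnextS t w : xnext t.+1 w = xnext t w - gamma *: normalize (est t.+1 w).
Proof. by rewrite /xnext /est runS. Qed.

Let step_le t w : enorm (xnext t w - xcur t w) <= gamma.
Proof.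
case: t => [|t].
  by rewrite /xnext /xcur /run /= subrr enorm0.
rewrite xnextS xcurS addrAC subrr add0r enormN enormZ ger0_norm//.
by rewrite ler_piMr// enorm_normalize.
Qed.

(* The estimation error minus its deterministic part, in units of [s]. *)
Definition scaled_error (w : Omega) (t : nat) : 'rV[R]_d :=
  s^-1 *: (est t w - grad F (xcur t w) + (1 - alpha) ^+ t *: grad F x0).

Let s0 : 0 < s.
Proof. by rewrite addr_gt0// mulr_gt0//; case/andP: alpha01. Qed.

Let al0 : 0 < alpha. Proof. by case/andP: alpha01. Qed.
Let al1 : 0 <= 1 - alpha. Proof. by case/andP: alpha01; lra. Qed.

Lemma scaled_error0 w : scaled_error w 0 = 0.
Proof.
by rewrite /scaled_error /est /xcur /run /= expr0 scale1r sub0r addNr scaler0.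
Qed.

Let next_error t w (qq : R) (zh z : Xi) : 'rV[R]_d :=
  s^-1 *: (new t w qq zh z - grad F (xnext t w)
           + (1 - alpha) ^+ t.+1 *: grad F x0).

Let scaled_errorS w t : scaled_error w t.+1 =
  next_error t w (q t.+1 w) (xih t.+1 w) (xi t.+1 w).
Proof. by rewrite /scaled_error xcurS estS. Qed.

Let hess_step t w (z : measurableTypeR R * Xi) : 'rV[R]_d :=
  (1 - alpha) *: scaled_error w t + ((1 - alpha) / s) *:
    (clip (hess_product hessf (xnext t w) (xcur t w) z) (2 * lh)
     - (grad F (xnext t w) - grad F (xcur t w))).

(** The correction [(1 - alpha) ^+ t *: grad F x0] contracts like the error itself and so drops out
    of the recursion. What is left is the Hessian noise, fixed before the gradient sample is
    integrated, then the gradient noise. *)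
Let next_errorE t w qq zh z : next_error t w qq zh z =
  hess_step t w (qq, zh) + (alpha / s) *:
    (clip (gradf (xnext t w) z) (2 * lg) - grad F (xnext t w)).
Proof.
rewrite /next_error /new /new_estimate /hess_step /scaled_error /hess_product /=.
move: (clip _ _) (clip _ _) => c1 c2; apply/rowP => j.
rewrite !mxE exprS; field; rewrite gt_eqF//.
Qed.

Notation draws := (draw_sigma_algebra q xi xih).

Let drawsI i : setI_closed (draws i).
Proof.
case: i => [t|[t|t]] _ _ [A mA <-] [B mB <-];
  by exists (A `&` B); [exact: measurableI|rewrite !setTI preimage_setI].
Qed.

Let drawsT i : draws i setT.
Proof. by case: i => [t|[t|t]]; exists setT => //; rewrite setTI preimage_setT. Qed.

Let drawsm i : draws i `<=` measurable.
Proof. by case: i => [t|[t|t]] _ [A mA <-]; exact: measurable_funP. Qed.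

Let past (t : nat) : set (nat + (nat + nat)) := [set i | (0 < draw_time i <= t)%N].

Notation OmegaS S := (g_sigma_algebraType (cylinders draws S)).

(** Adaptedness, through which independence of the next draws from [past t] becomes independence
    from the current state. *)
Let measurable_run t :
  [/\ measurable_coord (xcur t : OmegaS (past t) -> _),
      measurable_coord (xnext t : OmegaS (past t) -> _) &
      measurable_coord (est t : OmegaS (past t) -> _)].
Proof.
elim: t => [|t [mc mn me]].
  split; exact: measurable_coord_cst.
have sub : past t `<=` past t.+1.
  by move=> i; rewrite /past /= => /andP[h1 h2]; rewrite h1 leqW.
have up (f : Omega -> 'rV[R]_d) : measurable_coord (f : OmegaS (past t) -> _) ->
    measurable_coord (f : OmegaS (past t.+1) -> _).
  by move=> mf j; exact: (measurable_fun_cylinders_sub sub (mf j)).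
have mn' := up _ mn.
have me' : measurable_coord (est t.+1 : OmegaS (past t.+1) -> _).
  rewrite (_ : est t.+1 = fun w => new t w (q t.+1 w) (xih t.+1 w) (xi t.+1 w)).
    have mq : measurable_fun setT (q t.+1 : OmegaS (past t.+1) -> R).
      by apply: (measurable_draw drawsT (i := inl t.+1)) => [|B mB];
        [rewrite /past/= leqnn|exists B; rewrite ?setTI].
    have mzh : measurable_fun setT (xih t.+1 : OmegaS (past t.+1) -> Xi).
      by apply: (measurable_draw drawsT (i := inr (inr t.+1))) => [|B mB];
        [rewrite /past/= leqnn|exists B; rewrite ?setTI].
    have mz : measurable_fun setT (xi t.+1 : OmegaS (past t.+1) -> Xi).
      by apply: (measurable_draw drawsT (i := inr (inl t.+1))) => [|B mB];
        [rewrite /past/= leqnn|exists B; rewrite ?setTI].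
    exact: (measurable_new_estimate bcmg bcmh alpha (2 * lg) (2 * lh)
      (up _ mc) mn' (up _ me) mq mzh mz).
  by apply/funext => w; exact: estS.
split=> //.
- by rewrite (_ : xcur t.+1 = xnext t)//; apply/funext => w; exact: xcurS.
rewrite (_ : xnext t.+1 = fun w => xnext t w - gamma *: normalize (est t.+1 w)).
  apply: measurable_coordB => //; apply: measurable_coordZ => //.
  exact: measurable_coord_normalize.
by apply/funext => w; exact: xnextS.
Qed.

Let measurable_grad_comp (dT : measure_display) (T' : measurableType dT)
    (f : T' -> 'rV[R]_d) :
  measurable_coord f -> measurable_coord (fun t => grad F (f t)).
Proof.
move=> mf j.
have mg : measurable_fun setT (fun y : borel_rV R d => grad F y 0 j).
  exact: measurable_grad.
exact: (measurableT_comp mg (measurable_borel_rV mf)).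
Qed.

Let measurable_scaled_error t :
  measurable_coord (scaled_error ^~ t : OmegaS (past t) -> _).
Proof.
have [mc mn me] := measurable_run t.
apply: measurable_coordZ => //; apply: measurable_coordD.
  by apply: measurable_coordB => //; exact: measurable_grad_comp.
exact: measurable_coord_cst.
Qed.

Definition good (w : Omega) (t : nat) : R :=
  \prod_(i < t.+1) (enorm (scaled_error w i) <= r)%R%:R.

Lemma goodS w t :
  good w t.+1 = good w t * (enorm (scaled_error w t.+1) <= r)%R%:R.
Proof. by rewrite /good big_ord_recr. Qed.

Lemma good0 w : good w 0 = 1.
Proof. by rewrite /good big_ord1 scaled_error0 enorm0 r0. Qed.

Lemma goodP w t : good w t = 0 \/
  good w t = 1 /\ forall i, (i <= t)%N -> enorm (scaled_error w i) <= r.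
Proof.
elim: t => [|t [g0|[g1 ih]]].
- by right; rewrite good0; split=> // -[|//] _; rewrite scaled_error0 enorm0.
- by left; rewrite goodS g0 mul0r.
rewrite goodS g1 mul1r; case: (boolP (_ <= r)) => [h|_]; last by left.
right; split=> // i; rewrite leq_eqVlt => /orP[/eqP -> //|]; exact: ih.
Qed.

Lemma good_ge0 w t : 0 <= good w t.
Proof. by case: (goodP w t) => [->|[-> _]]. Qed.

Let measurable_good t : measurable_fun setT (good ^~ t : OmegaS (past t) -> R).
Proof.
apply: measurable_prod => i _.
have mi : measurable_coord (scaled_error ^~ i : OmegaS (past t) -> _).
  have sub : past i `<=` past t.
    move=> k; rewrite /past /= => /andP[-> h].
    by rewrite (leq_trans h)// -ltnS.
  by move=> j; exact: (measurable_fun_cylinders_sub sub (@measurable_scaled_error i j)).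
rewrite (_ : (fun w => _) =
    (fun w => if enorm (scaled_error w i) <= r then 1 else 0)).
  apply: measurable_fun_ifT => //; apply: measurable_fun_ler => //.
  exact: measurable_enorm.
by apply/funext => w; case: (_ <= r).
Qed.

Definition exp_potential w t : R := expR (16^-1 * pot (scaled_error w t)).

Let measurable_exp_pot (dT : measure_display) (T' : measurableType dT)
    (f : T' -> 'rV[R]_d) (a : R) : measurable_coord f ->
  measurable_fun setT (fun t => expR (16^-1 * pot (f t) + a)).
Proof.
move=> mf; apply: (measurableT_comp (@measurable_expR R)).
apply: measurable_funD => //; apply: measurable_funM => //.
exact: measurable_pot.
Qed.

Let measurable_hess_step (dT : measure_display) (T' : measurableType dT)
    (w : T' -> Omega) (t : nat) (qq : T' -> R) (zh : T' -> Xi) :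
  measurable_fun setT (w : T' -> OmegaS (past t)) ->
  measurable_fun setT qq -> measurable_fun setT zh ->
  measurable_coord (fun u => hess_step t (w u) (qq u, zh u)).
Proof.
move=> mw mq mzh; have [mc mn me] := measurable_run t.
have comp (f : Omega -> 'rV[R]_d) : measurable_coord (f : OmegaS (past t) -> _) ->
    measurable_coord (fun u => f (w u)).
  by move=> mf j; exact: (measurableT_comp (mf j) mw).
apply: measurable_coordD; apply: measurable_coordZ => //.
  exact: (comp _ (@measurable_scaled_error t)).
apply: measurable_coordB; last first.
  by apply: measurable_coordB; apply: measurable_grad_comp; exact: comp.
apply: measurable_coord_clip.
by apply: (measurable_hess_term bcmh) => //; exact: comp.
Qed.

Let measurable_next_error (dT : measure_display) (T' : measurableType dT)
    (w : T' -> Omega) (t : nat) (qq : T' -> R) (zh z : T' -> Xi) :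
  measurable_fun setT (w : T' -> OmegaS (past t)) ->
  measurable_fun setT qq -> measurable_fun setT zh -> measurable_fun setT z ->
  measurable_coord (fun u => next_error t (w u) (qq u) (zh u) (z u)).
Proof.
move=> mw mq mzh mz; have [mc mn me] := measurable_run t.
have comp (f : Omega -> 'rV[R]_d) : measurable_coord (f : OmegaS (past t) -> _) ->
    measurable_coord (fun u => f (w u)).
  by move=> mf j; exact: (measurableT_comp (mf j) mw).
apply: measurable_coordZ => //; apply: measurable_coordD; last first.
  exact: measurable_coord_cst.
apply: measurable_coordB; last by apply: measurable_grad_comp; exact: comp.
exact: (measurable_new_estimate bcmg bcmh alpha (2 * lg) (2 * lh)
      (comp _ mc) (comp _ mn) (comp _ me) mq mzh mz).
Qed.

(** To be supplied by the descent inequality. [xnext t] is the point where iteration [t.+1] samples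
    its gradient, yet the bound there depends only on the errors up to [t]; this offset keeps the
    argument from being circular. *)
Hypothesis grad_le_lg : forall w t, (t.+1 < T)%N -> good w t = 1 ->
  enorm (grad F (xnext t w)) <= lg.

Let hess_pot_step t w : good w t = 1 ->
  (\int[(uniform_prob (@ltr01 R) \x D)%E]_z
     (expR (16^-1 * pot (hess_step t w z)))%:E <=
   (expR (16^-1 * pot ((1 - alpha) *: scaled_error w t) + 16 * alpha))%:E)%E.
Proof.
move=> gw; have [_ sL] := smoothF.
apply: (@integral_pot_step _ _ _ _ _ _ _ _ _ p) => //.
- exact: measurable_hess_product bcmh.
- move=> j; split.
    exact: (integrable_hess_product _ _ p12 L0 sh0 smoothF dgF bcmh).
  exact: (integral_hess_product _ _ p12 L0 sh0 smoothF dgF bcmh).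
- by rewrite divr_ge0// ltW.
- rewrite mulrAC ler_pdivrMr// mul1r /s.
  by have := mulr_ge0 (ltW al0) (ltW lh0); have := mulr_ge0 (ltW al0) (ltW lg0); lra.
- apply: (le_trans (sL _ _)); apply: le_trans lhL.
  by rewrite ler_pM2l// step_le.
- exact: (hess_product_moment p12 L0 sh0 smoothF dgF bcmh (step_le t w)).
Qed.

Let hess_pot_step_iterated t w : good w t = 1 ->
  (\int[uniform_prob (@ltr01 R)]_qq \int[D]_y
     (expR (16^-1 * pot (hess_step t w (qq, y)) + 16 * alpha))%:E <=
   (expR (16^-1 * pot ((1 - alpha) *: scaled_error w t) + 32 * alpha))%:E)%E.
Proof.
move=> gw.
have mh : measurable_coord (hess_step t w).
  rewrite (_ : hess_step t w = fun z => hess_step t w (z.1, z.2)).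
    exact: (measurable_hess_step (measurable_cst (w : OmegaS (past t)))
      (@measurable_fst _ _ (measurableTypeR R) Xi) (@measurable_snd _ _ _ _)).
  by apply/funext => -[].
have me a := measurable_exp_pot a mh.
rewrite -(fubini_tonelli1 (fun z =>
  (expR (16^-1 * pot (hess_step t w z) + 16 * alpha))%:E)); last 2 first.
- exact/measurable_EFinP.
- by move=> z; rewrite lee_fin expR_ge0.
under eq_integral do rewrite expRD EFinM muleC.
rewrite ge0_integralZl ?lee_fin ?expR_ge0//; last first.
  apply/measurable_EFinP; have := me 0.
  by under eq_fun do rewrite addr0.
rewrite (_ : 32 * alpha = 16 * alpha + 16 * alpha); last by ring.
rewrite addrA expRD EFinM muleC lee_pmul2r ?lte_fin ?expR_gt0//.
exact: hess_pot_step.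
Qed.

Let grad_pot_step t w m : (t.+1 < T)%N -> good w t = 1 ->
  (\int[D]_z (expR (16^-1 * pot (m + (alpha / s) *:
      (clip (gradf (xnext t w) z) (2 * lg) - grad F (xnext t w)))))%:E <=
   (expR (16^-1 * pot m + 16 * alpha))%:E)%E.
Proof.
move=> tT gw; apply: (@integral_pot_step _ _ _ _ _ _ _ _ _ p) => //.
- exact: measurable_stoch_grad bcmg.
- by move=> j; have [_ /(_ (xnext t w) j)[h]] := bcmg; rewrite unlock.
- by rewrite divr_ge0// ltW.
- by rewrite mulrAC ler_pdivrMr// mul1r /s lerDl ltW.
- exact: grad_le_lg.
- exact: (stoch_grad_moment (xnext t w) bcmg lg0 lgP).
Qed.

Let uniform_draw t : (0 < t < T)%N -> forall B, measurable B ->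
  P (q t @^-1` B) = uniform_prob (@ltr01 R) B.
Proof. by move=> tT B mB; have [/(_ t tT B mB)] := samples. Qed.

Let xi_draw t : (0 < t < T)%N -> forall B, measurable B ->
  P (xi t @^-1` B) = D B.
Proof. by move=> tT B mB; have [_ /(_ t tT B mB)[]] := samples. Qed.

Let xih_draw t : (0 < t < T)%N -> forall B, measurable B ->
  P (xih t @^-1` B) = D B.
Proof. by move=> tT B mB; have [_ /(_ t tT B mB)[]] := samples. Qed.

(* The draws of the iteration are integrated out in reverse order: gradient
   sample, Hessian sample, uniform point of the segment. *)
Lemma expected_potential_step t : (t.+1 < T)%N ->
  (\int[P]_w (exp_potential w t.+1 * good w t)%:E <=
   (1 - alpha / 2)%:E * \int[P]_w (exp_potential w t * good w t)%:E
   + (alpha / 2 * expR 65)%:E)%E.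
Proof.
move=> tT; have tT' : (0 < t.+1 < T)%N by rewrite tT.
have [_ _ ind] := samples.
pose S' := [set i | (0 < draw_time i < T)%N].
(* What is known before each of the three integrations: [S2] precedes the gradient sample, [S1] the
   Hessian sample, [S0] the uniform point. *)
pose S0 := past t; pose S1 := S0 `|` [set inl t.+1].
pose S2 := S1 `|` [set inr (inr t.+1)].
have S0S' : S0 `<=` S'.
  move=> i; rewrite /S0 /past /S' /= => /andP[-> h] /=.
  by rewrite (leq_ltn_trans h)// ltnW.
have S1S' : S1 `<=` S' by move=> i [/S0S'|->].
have S2S' : S2 `<=` S' by move=> i [/S1S'|->].
have S01 : S0 `<=` S1 by left.
have S12 : S1 `<=` S2 by left.
have nS0 : ~ S0 (inl t.+1) by rewrite /S0 /past /= ltnn.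
have nS1 : ~ S1 (inr (inr t.+1)) by move=> [|//]; rewrite /S0 /past /= ltnn.
have nS2 : ~ S2 (inr (inl t.+1)).
  by move=> [[|//]|//]; rewrite /S0 /past /= ltnn.
have mq1 : measurable_fun setT (q t.+1 : OmegaS S1 -> R).
  by apply: (measurable_draw drawsT (i := inl t.+1)) => [|B mB];
    [right|exists B; rewrite ?setTI].
have mq2 := measurable_fun_cylinders_sub S12 mq1.
have mzh2 : measurable_fun setT (xih t.+1 : OmegaS S2 -> Xi).
  by apply: (measurable_draw drawsT (i := inr (inr t.+1))) => [|B mB];
    [right|exists B; rewrite ?setTI].
have mid (S : set (nat + (nat + nat))) : S0 `<=` S ->
    measurable_fun setT (idfun : OmegaS S -> OmegaS S0).
  by move=> SS; exact: (measurable_fun_cylinders_sub SS (@measurable_id _ (OmegaS S0) setT)).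
have mg (S : set (nat + (nat + nat))) : S0 `<=` S ->
    measurable_fun setT (good ^~ t : OmegaS S -> R).
  by move=> SS; exact: (measurable_fun_cylinders_sub SS (@measurable_good t)).
(* [Phi3], [Phi2] and [Phi1] bound the weighted potential with no, one and two draws integrated out.
   The [16 * alpha] in [Phi2] is the cost of the gradient sample, and [+ 0] gives [Phi3] the same
   shape. *)
pose Phi3 (z : OmegaS S2 * Xi) : \bar R := (expR (16^-1 *
  pot (next_error t z.1 (q t.+1 z.1) (xih t.+1 z.1) z.2) + 0) * good z.1 t)%:E.
pose Phi2 (z : OmegaS S1 * Xi) : \bar R := (expR (16^-1 *
  pot (hess_step t z.1 (q t.+1 z.1, z.2)) + 16 * alpha) * good z.1 t)%:E.
pose Phi1' (z : OmegaS S0 * measurableTypeR R * Xi) : \bar R := (expR (16^-1 *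
  pot (hess_step t z.1.1 (z.1.2, z.2)) + 16 * alpha) * good z.1.1 t)%:E.
pose Phi1 (z : OmegaS S0 * measurableTypeR R) : \bar R :=
  (\int[D]_y Phi1' (z, y))%E.
have mPhi3 : measurable_fun setT Phi3.
  have mf : measurable_fun setT (fst : OmegaS S2 * Xi -> OmegaS S2).
    exact: measurable_fst.
  apply/measurable_EFinP; apply: measurable_funM; last first.
    exact: (measurableT_comp (mg _ (subset_trans S01 S12)) mf).
  apply: measurable_exp_pot; apply: measurable_next_error.
  - exact: (measurableT_comp (mid _ (subset_trans S01 S12)) mf).
  - exact: (measurableT_comp mq2 mf).
  - exact: (measurableT_comp mzh2 mf).
  - exact: measurable_snd.
have mPhi2 : measurable_fun setT Phi2.
  have mf : measurable_fun setT (fst : OmegaS S1 * Xi -> OmegaS S1).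
    exact: measurable_fst.
  apply/measurable_EFinP; apply: measurable_funM; last first.
    exact: (measurableT_comp (mg _ S01) mf).
  apply: measurable_exp_pot; apply: measurable_hess_step.
  - exact: (measurableT_comp (mid _ S01) mf).
  - exact: (measurableT_comp mq1 mf).
  - exact: measurable_snd.
have mPhi1' : measurable_fun setT Phi1'.
  have mf : measurable_fun setT
      (fst : OmegaS S0 * measurableTypeR R * Xi -> OmegaS S0 * measurableTypeR R).
    exact: measurable_fst.
  have mff := measurableT_comp (@measurable_fst _ _ (OmegaS S0) (measurableTypeR R)) mf.
  have mfs := measurableT_comp (@measurable_snd _ _ (OmegaS S0) (measurableTypeR R)) mf.
  apply/measurable_EFinP; apply: measurable_funM; last first.
    exact: (measurableT_comp (@measurable_good t) mff).
  apply: measurable_exp_pot; apply: measurable_hess_step.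
  - exact: mff.
  - exact: mfs.
  - exact: measurable_snd.
have mPhi1 : measurable_fun setT Phi1.
  apply: (measurable_fun_fubini_tonelli_F Phi1') => // z.
  by rewrite lee_fin mulr_ge0 ?expR_ge0 ?good_ge0.
have Phi3_ge0 z : (0 <= Phi3 z)%E by rewrite lee_fin mulr_ge0 ?expR_ge0 ?good_ge0.
have Phi2_ge0 z : (0 <= Phi2 z)%E by rewrite lee_fin mulr_ge0 ?expR_ge0 ?good_ge0.
have Phi1'_ge0 z : (0 <= Phi1' z)%E.
  by rewrite lee_fin mulr_ge0 ?expR_ge0 ?good_ge0.
have Phi1_ge0 z : (0 <= Phi1 z)%E by apply: integral_ge0 => y _.
apply: (@le_trans _ _ (\int[P]_w Phi3 (w, xi t.+1 w))%E).
  rewrite le_eqVlt; apply/orP; left; apply/eqP.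
  by apply: eq_integral => w _; rewrite /exp_potential scaled_errorS /Phi3 addr0.
rewrite (@integral_fresh_draw _ _ _ P _ draws drawsI drawsT drawsm S2 S'
  (inr (inl t.+1)) _ _ D (xi t.+1) Phi3 ind S2S' _ nS2)//; last 2 first.
- by move=> B mB; exists B; rewrite ?setTI.
- exact: xi_draw.
apply: (@le_trans _ _ (\int[P]_w Phi2 (w, xih t.+1 w))%E).
  apply: le_integral_ge0 => w; first by apply: integral_ge0.
  have [g0|[g1 _]] := goodP w t.
    rewrite integral0_eq => [|z _]; first by rewrite /Phi2 /= g0 mulr0.
    by rewrite /Phi3 /= g0 mulr0.
  rewrite /Phi2 /= g1 mulr1; apply: le_trans (grad_pot_step _ tT g1).
  rewrite le_eqVlt; apply/orP; left; apply/eqP.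
  by apply: eq_integral => z _; rewrite /Phi3 /= g1 mulr1 addr0 next_errorE.
rewrite (@integral_fresh_draw _ _ _ P _ draws drawsI drawsT drawsm S1 S'
  (inr (inr t.+1)) _ _ D (xih t.+1) Phi2 ind S1S' _ nS1)//; last 2 first.
- by move=> B mB; exists B; rewrite ?setTI.
- exact: xih_draw.
(* By conversion: integrating [Phi2] over the Hessian sample gives [Phi1] at the drawn point. *)
apply: (@le_trans _ _ (\int[P]_w Phi1 (w, q t.+1 w))%E); first exact: lexx.
rewrite (@integral_fresh_draw _ _ _ P _ draws drawsI drawsT drawsm S0 S'
  (inl t.+1) _ (measurableTypeR R) (uniform_prob (@ltr01 R)) (q t.+1) Phi1 ind
  S0S' _ nS0)//; last 2 first.
- by move=> B mB; exists B; rewrite ?setTI.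
- exact: uniform_draw.
have /andP[al0' al1'] := alpha01.
have mZ : measurable_fun setT (fun w => exp_potential w t * good w t).
  apply: (measurable_fun_cylinders drawsm (S := S0)).
  apply: measurable_funM; last exact: measurable_good.
  have := measurable_exp_pot 0 (@measurable_scaled_error t).
  by under eq_fun do rewrite addr0.
apply: (@le_trans _ _ (\int[P]_w ((1 - alpha / 2)%:E *
    (exp_potential w t * good w t)%:E + (alpha / 2 * expR 65)%:E))%E).
  apply: le_integral_ge0 => w; first exact: integral_ge0.
  have [g0|[g1 _]] := goodP w t.
    rewrite integral0_eq => [|z _].
      rewrite g0 mulr0 mule0 add0e lee_fin mulr_ge0 ?expR_ge0//.
      by rewrite divr_ge0// ltW.
    rewrite /Phi1 integral0_eq// => y _.
    by rewrite /Phi1' /= g0 mulr0.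
  rewrite g1 mulr1.
  have h := expR_pot_drift (scaled_error w t) (t := alpha).
  rewrite (ltW al0') al1' in h.
  apply: (@le_trans _ _ (expR (16^-1 * pot ((1 - alpha) *: scaled_error w t)
    + 32 * alpha))%:E); last by rewrite -EFinM -EFinD lee_fin; exact: h.
  apply: le_trans (hess_pot_step_iterated g1).
  rewrite le_eqVlt; apply/orP; left; apply/eqP.
  apply: eq_integral => qq _; apply: eq_integral => y _.
  by rewrite /Phi1' /= g1 mulr1.
rewrite ge0_integralD//; last 3 first.
- by move=> w _; rewrite -EFinM lee_fin !mulr_ge0 ?expR_ge0 ?good_ge0//; lra.
- by apply/measurable_EFinP; apply: measurable_funM.
- by move=> w _; rewrite lee_fin mulr_ge0 ?expR_ge0//; lra.
rewrite integral_cst//= probability_setT mule1 leeD2r//.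
rewrite le_eqVlt; apply/orP; left; apply/eqP.
pose Zt w := (exp_potential w t * good w t)%:E.
apply: (@ge0_integralZl _ _ _ P setT measurableT Zt _ (1 - alpha / 2)%:E).
- exact/measurable_EFinP.
- by move=> w _; rewrite lee_fin !mulr_ge0 ?expR_ge0 ?good_ge0.
- by rewrite lee_fin; lra.
Qed.

Let K : R := expR 65.

Let measurable_weight (f : Omega -> R) t : measurable_fun setT f ->
  measurable_fun setT (fun w => f w * good w t).
Proof.
move=> mf; apply: measurable_funM => //.
exact: (measurable_fun_cylinders drawsm (@measurable_good t)).
Qed.

Let measurable_exp_potential t : measurable_fun setT (exp_potential ^~ t).
Proof.
apply: (measurable_fun_cylinders drawsm (S := past t)).
have := measurable_exp_pot 0 (@measurable_scaled_error t).
by under eq_fun do rewrite addr0.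
Qed.

(** [K] is the fixed point of the affine recursion of [expected_potential_step], and the initial
    value [expR 16^-1] lies below it. *)
Let expected_potential_good t : (t < T)%N ->
  (\int[P]_w (exp_potential w t * good w t)%:E <= K%:E)%E.
Proof.
elim: t => [_|t ih tT].
  apply: (@le_trans _ _ (\int[P]_w K%:E)%E); last first.
    by rewrite integral_cst//= probability_setT mule1.
  apply: le_integral_ge0 => w; rewrite lee_fin good0 mulr1 ?expR_ge0//.
  by rewrite /exp_potential scaled_error0 pot0 ler_expR; lra.
apply: (@le_trans _ _ (\int[P]_w (exp_potential w t.+1 * good w t)%:E)%E).
  apply: le_integral_ge0 => w; rewrite lee_fin ?mulr_ge0 ?expR_ge0 ?good_ge0//.
  rewrite ler_wpM2l ?expR_ge0// goodS ler_piMr ?good_ge0//.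
  by case: (_ <= r).
apply: (le_trans (expected_potential_step tT)).
have k0 : 0 <= 1 - alpha / 2 by have /andP[] := alpha01; lra.
apply: (@le_trans _ _ ((1 - alpha / 2)%:E * K%:E + (alpha / 2 * K)%:E)%E).
  rewrite leeD2r// lee_wpmul2l ?lee_fin//; exact/ih/ltnW.
by rewrite -EFinM -EFinD lee_fin; lra.
Qed.

(** The weight lags the potential by one step, so that the runs failing for the first time at [t.+1]
    still count; Markov's inequality is applied to them. *)
Let expected_potential t : (t.+1 < T)%N ->
  (\int[P]_w (exp_potential w t.+1 * good w t)%:E <= K%:E)%E.
Proof.
move=> tT; apply: (le_trans (expected_potential_step tT)).
have k0 : 0 <= 1 - alpha / 2 by have /andP[] := alpha01; lra.
apply: (@le_trans _ _ ((1 - alpha / 2)%:E * K%:E + (alpha / 2 * K)%:E)%E).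
  by rewrite leeD2r// lee_wpmul2l ?lee_fin//; exact/expected_potential_good/ltnW.
by rewrite -EFinM -EFinD lee_fin; lra.
Qed.

Let good_le1 w t : good w t <= 1.
Proof. by case: (goodP w t) => [->|[-> _]]. Qed.

(** Each step adds at most the probability of a first failure: there the previous weight is 1 and
    the potential exceeds [expR (r / 16)]. *)
Let expected_failure t : (t < T)%N ->
  (\int[P]_w (1 - good w t)%:E <= (t%:R * (K * expR (- (r / 16))))%:E)%E.
Proof.
elim: t => [_|t ih tT].
  by rewrite integral0_eq ?mul0r// => w _; rewrite good0 subrr.
set c := expR (- (r / 16)); have c0 : 0 <= c by exact: expR_ge0.
pose Z w := (c%:E * (exp_potential w t.+1 * good w t)%:E)%E.
have mg : measurable_fun setT (good ^~ t).
  exact: (measurable_fun_cylinders drawsm (@measurable_good t)).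
apply: (@le_trans _ _ (\int[P]_w ((1 - good w t)%:E + Z w))%E).
  apply: le_integral_ge0 => w; first by rewrite lee_fin subr_ge0.
  rewrite /Z -EFinM -EFinD lee_fin goodS.
  case: (leP (enorm (scaled_error w t.+1)) r) => [h|h].
    by rewrite mulr1 lerDl !mulr_ge0 ?expR_ge0 ?good_ge0.
  rewrite mulr0 subr0; have [->|[-> _]] := goodP w t.
    by rewrite subr0 mulr0 mulr0 addr0.
  rewrite subrr add0r mulr1 /c /exp_potential -expRD.
  rewrite -[leLHS]expR0 ler_expR.
  by have := enorm_le_pot (scaled_error w t.+1); lra.
rewrite ge0_integralD//; last 4 first.
- by move=> w _; rewrite lee_fin subr_ge0.
- by apply/measurable_EFinP; exact: measurable_funB.
- by move=> w _; rewrite /Z -EFinM lee_fin !mulr_ge0 ?expR_ge0 ?good_ge0.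
- apply/measurable_EFinP; apply: measurable_funM => //.
  exact: measurable_weight.
rewrite mulrSr mulrDl mul1r EFinD; apply: leeD; first exact/ih/ltnW.
pose Zt w := (exp_potential w t.+1 * good w t)%:E.
have -> : (\int[P]_w Z w = c%:E * \int[P]_w Zt w)%E.
  apply: (@ge0_integralZl _ _ _ P setT measurableT Zt).
  - by apply/measurable_EFinP; exact: measurable_weight.
  - by move=> w _; rewrite lee_fin mulr_ge0 ?expR_ge0 ?good_ge0.
  - by rewrite lee_fin.
rewrite mulrC EFinM lee_wpmul2l ?lee_fin//.
exact: expected_potential.
Qed.

Lemma good_probability t (A : set Omega) : (t < T)%N -> measurable A ->
  (forall w, good w t = 1 -> A w) ->
  ((1 - t%:R * (expR 65 * expR (- (r / 16))))%:E <= P A)%E.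
Proof.
move=> tT mA gA.
have mAC : measurable (~` A) by exact: measurableC.
have h : (P (~` A) <= (t%:R * (expR 65 * expR (- (r / 16))))%:E)%E.
  rewrite -(setIT (~` A)) -integral_indic//.
  apply: le_trans (expected_failure tT); apply: le_integral_ge0 => w.
    by rewrite lee_fin.
  rewrite lee_fin indicE; case: (goodP w t) => [->|[g1 _]].
    by rewrite subr0; case: (_ \in _).
  by rewrite g1 subrr memNset//= => nA; exact/nA/gA.
rewrite probability_setC// in h; move: h.
rewrite -(fineK (fin_num_measure P _ mA)) -EFinB !lee_fin; lra.
Qed.

Lemma measurable_grad_run t :
  measurable_fun setT (fun w => enorm (grad F (run w t).1.1)).
Proof.
have [mc _ _] := measurable_run t.
apply: (measurable_fun_cylinders drawsm (S := past t)).
by apply: measurable_enorm; exact: measurable_grad_comp.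
Qed.

End process.

(** * Descent on the good event *)

Section descent_along_run.
Context {R : realType} {d : nat} {Xi : Type}.
Variables (gradf : 'rV[R]_d -> Xi -> 'rV[R]_d)
  (hessf : 'rV[R]_d -> Xi -> 'M[R]_d).
Variables (gamma alpha lambda lambda_h : R) (x0 : 'rV[R]_d).
Variables (q : nat -> R) (xi xih : nat -> Xi).
Variables (F : 'rV[R]_d -> R) (L Fstar s r : R) (T : nat).
Hypothesis L0 : 0 < L.
Hypothesis smoothF : smooth L F.
Hypothesis lbF : forall x, Fstar <= F x.
Hypothesis gamma0 : 0 <= gamma.
Hypothesis alpha01 : 0 < alpha <= 1.
Hypothesis s0 : 0 < s.
Hypothesis r0 : 0 <= r.

Let Delta := F x0 - Fstar.
Let st t := nsgd_state gradf hessf gamma alpha lambda lambda_h x0 q xi xih t.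
Let err t := (st t).2 - grad F (st t).1.1.

Hypothesis budget :
  2 * gamma * (T%:R * (s * r) + 2 * Num.sqrt (L * Delta) / alpha)
  + T%:R * (L / 2 * gamma ^+ 2) <= Delta.

Lemma grad_le_gap x (c : R) : 0 <= c -> F x - Fstar <= 2 * c ->
  enorm (grad F x) <= 2 * Num.sqrt (L * c).
Proof.
move=> c0 Fx; rewrite -(@ler_pXn2r _ 2)// ?nnegrE ?enorm_ge0 ?mulr_ge0//.
rewrite exprMn (sqr_sqrtr (mulr_ge0 (ltW L0) c0)).
apply: (le_trans (grad_sqr_le smoothF x L0 lbF)).
have := ler_wpM2l (ltW L0) Fx; lra.
Qed.

Let Delta0 : 0 <= Delta. Proof. by rewrite subr_ge0. Qed.

Let geometric n : \sum_(i < n) (1 - alpha) ^+ i.+1 <= alpha^-1.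
Proof.
have /andP[a0 a1] := alpha01.
suff : alpha * \sum_(i < n) (1 - alpha) ^+ i.+1 + (1 - alpha) ^+ n.+1 <= 1 - alpha.
  have p0 : 0 <= (1 - alpha) ^+ n.+1 by rewrite exprn_ge0// subr_ge0.
  move=> h; rewrite -[leRHS]mul1r ler_pdivlMr// mulrC; lra.
elim: n => [|n ih]; first by rewrite big_ord0 mulr0 add0r expr1.
by rewrite big_ord_recr/= mulrDr [(1 - alpha) ^+ n.+2]exprS; lra.
Qed.

Let sum_recr (a : nat -> R) n :
  \sum_(i < n.+1) a i = \sum_(i < n) a i + a n.
Proof. by rewrite big_ord_recr. Qed.

Let sum_recl (a : nat -> R) n :
  \sum_(i < n.+1) a i = a 0 + \sum_(i < n) a i.+1.
Proof. by rewrite big_ord_recl. Qed.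

Let gnorm i := enorm (grad F (st i).1.1).

Let st_step t : (st t.+1).1.1 = (st t).1.2 /\
  (st t.+1).1.2 = (st t).1.2 - gamma *: normalize (st t.+1).2.
Proof. by rewrite /st /=; case: (nsgd_state _ _ _ _ _ _ _ _ _ _ t) => [[]]. Qed.

(** Summing [normalized_step]: each step pays twice its error, which is at most [s * r] plus a
    geometrically decaying share of the initial gradient. [budget] bounds the total cost by the
    initial gap. *)
Lemma run_descent n : (n < T)%N ->
  (forall i, (i <= n)%N ->
     enorm (s^-1 *: (err i + (1 - alpha) ^+ i *: grad F x0)) <= r) ->
  F (st n).1.2 - Fstar + gamma * \sum_(i < n) gnorm i.+1
  <= 2 * Delta.
Proof.
move=> nT err_le; have /andP[a0 a1] := alpha01.
have g0 : enorm (grad F x0) <= 2 * Num.sqrt (L * Delta).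
  by apply: grad_le_gap => //; rewrite -/Delta; have := Delta0; lra.
have errb i : (i <= n)%N ->
    enorm (err i) <= s * r + (1 - alpha) ^+ i * enorm (grad F x0).
  move=> /err_le; have : 0 <= (1 - alpha) ^+ i by rewrite exprn_ge0 ?subr_ge0.
  move: ((1 - alpha) ^+ i) => c c0.
  rewrite enormZ ger0_norm ?invr_ge0 ?(ltW s0)//.
  rewrite mulrC ler_pdivrMr// (mulrC r) => h.
  have := ler_enormB (err i + c *: grad F x0) (c *: grad F x0).
  rewrite addrK (enormZ c) ger0_norm//; lra.
have main k : (k <= n)%N ->
  F (st k).1.2 - Fstar + gamma * \sum_(i < k) gnorm i.+1 <=
  Delta + 2 * gamma * (k%:R * (s * r) +
    enorm (grad F x0) * \sum_(i < k) (1 - alpha) ^+ i.+1)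
  + k%:R * (L / 2 * gamma ^+ 2).
  elim: k => [_|k ih kn].
    by rewrite !big_ord0 !mulr0 !mul0r !addr0 mulr0 addr0 lexx.
  have := ih (ltnW kn); have [E1 E2] := st_step k.
  have := normalized_step smoothF (st k).1.2 (st k.+1).2 gamma0 (ltW L0).
  rewrite (sum_recr (fun i => gnorm i.+1)) (sum_recr (fun i => (1 - alpha) ^+ i.+1)).
  rewrite -E2 -E1 -/(err k.+1) -/(gnorm k.+1).
  have := ler_wpM2l gamma0 (errb _ kn).
  move: (F (st k.+1).1.2) (F (st k.+1).1.1) (gnorm k.+1) (enorm (err k.+1)).
  move: ((1 - alpha) ^+ k.+1) (\sum_(i < k) gnorm i.+1) (enorm (grad F x0)).
  move: (\sum_(i < k) _) => S1 a S2 g F1 F2 gk ek.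
  have -> : k.+1%:R = k%:R + 1 :> R by rewrite natr1.
  move: (k%:R) => kr h3 h1 h2; lra.
have kT : n%:R <= T%:R :> R by rewrite ler_nat ltnW.
apply: (le_trans (main n (leqnn n))).
have h1 : enorm (grad F x0) * \sum_(i < n) (1 - alpha) ^+ i.+1 <=
    2 * Num.sqrt (L * Delta) / alpha.
  apply: ler_pM => //; first exact: enorm_ge0.
  by apply: sumr_ge0 => i _; rewrite exprn_ge0// subr_ge0.
have h2 : n%:R * (s * r) <= T%:R * (s * r).
  by rewrite ler_wpM2r// mulr_ge0// ltW.
have h3 : n%:R * (L / 2 * gamma ^+ 2) <= T%:R * (L / 2 * gamma ^+ 2).
  by rewrite ler_wpM2r// mulr_ge0 ?sqr_ge0// divr_ge0// ltW.
have h4 := ler_wpM2l gamma0 (lerD h2 h1).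
by have := budget; lra.
Qed.

Lemma run_grad_le n : (n < T)%N ->
  (forall i, (i <= n)%N ->
     enorm (s^-1 *: (err i + (1 - alpha) ^+ i *: grad F x0)) <= r) ->
  enorm (grad F (st n).1.2) <= 2 * Num.sqrt (L * Delta).
Proof.
move=> nT /(run_descent nT) h; apply: grad_le_gap => //.
apply: le_trans h; rewrite lerDl mulr_ge0//.
by apply: sumr_ge0 => i _; exact: enorm_ge0.
Qed.

(* Since [x_0 = x_1], the term [t = 0] at most doubles the sum over [t >= 1]. *)
Lemma run_grad_sum : (1 < T)%N ->
  (forall i, (i < T)%N ->
     enorm (s^-1 *: (err i + (1 - alpha) ^+ i *: grad F x0)) <= r) ->
  gamma * \sum_(i < T) gnorm i <= 4 * Delta.
Proof.
case E : T => [//|n] n0 h; have nT : (n < T)%N by rewrite E.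
have {}h : forall i, (i <= n)%N ->
   enorm (s^-1 *: (err i + (1 - alpha) ^+ i *: grad F x0)) <= r by move=> i /h.
have := run_descent nT h; rewrite sum_recl.
have h3 : gnorm 0 <= \sum_(i < n) gnorm i.+1.
  case: n n0 {h nT E} => // n _; rewrite (sum_recl (fun i => gnorm i.+1)).
  rewrite (_ : gnorm 1 = gnorm 0); last by rewrite /gnorm (st_step 0).1.
  by rewrite lerDl; apply: sumr_ge0 => i _; exact: enorm_ge0.
have := ler_wpM2l gamma0 h3; have := lbF (st n).1.2; lra.
Qed.

End descent_along_run.

(** * Choice of the parameters *)

(* To be read with [t = T], [tau = T `^ ((p - 1) / (2 * p - 1))],
   [A = alpha `^ p^-1], [Q = alpha `^ ((p - 1) / p)] and
   [ell = ln (T / delta)]. *)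
Section stepsize_bounds.
Context {R : realType}.
Variables (t alpha tau A Q ell Delta L sigma sigma_h c : R).
Hypothesis t0 : 0 < t.
Hypothesis alpha0 : 0 < alpha.
Hypothesis tau1 : 1 <= tau.
Hypothesis ell1 : 1 <= ell.
Hypothesis Delta0 : 0 < Delta.
Hypothesis L0 : 0 < L.
Hypothesis sigma0 : 0 < sigma.
Hypothesis sigma_h0 : 0 < sigma_h.
Hypothesis c0 : 0 < c.
Hypothesis alphaE : alpha * t = tau.
Hypothesis AE : A * t = tau ^+ 2.
Hypothesis QE : Q * tau = 1.
Hypothesis tau_t : tau ^+ 2 <= t.

Let h := Num.sqrt (Delta / L).
Let w := Num.sqrt (Delta * A / ((L + sigma_h) * t * ell)).
Let gamma := c * Num.min (Num.sqrt (Delta / (L * t)))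
  (Num.min (alpha * h) (Num.min (h / (alpha * t * ell))
  (Num.min (Delta / (sigma * Q * t * ell)) w))).

Let tau0 : 0 < tau. Proof. exact: lt_le_trans ltr01 tau1. Qed.
Let ell0 : 0 < ell. Proof. exact: lt_le_trans ltr01 ell1. Qed.
Let Lsh0 : 0 < L + sigma_h. Proof. exact: addr_gt0. Qed.
Let A0 : 0 < A.
Proof. by rewrite -(pmulr_lgt0 _ t0) AE exprn_gt0. Qed.
Let Q0 : 0 < Q.
Proof. by rewrite -(pmulr_lgt0 _ tau0) QE. Qed.
Let h0 : 0 < h. Proof. by rewrite sqrtr_gt0 divr_gt0. Qed.
Let w0 : 0 < w. Proof. by rewrite sqrtr_gt0 divr_gt0 ?mulr_gt0. Qed.

Let hE : L * h ^+ 2 = Delta.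
Proof. by rewrite sqr_sqrtr ?divr_ge0 ?ltW//; field; rewrite gt_eqF. Qed.

Let sqrtLD : Num.sqrt (L * Delta) = L * h.
Proof.
apply/eqP; rewrite -(@eqrXn2 _ 2)// ?sqrtr_ge0 ?mulr_ge0 ?ltW//.
rewrite sqr_sqrtr ?mulr_ge0 ?ltW// exprMn; apply/eqP.
by have := hE; move: (h) => h' <-; ring.
Qed.

Let wE : w ^+ 2 * ((L + sigma_h) * t * ell) = Delta * A.
Proof.
rewrite sqr_sqrtr ?divr_ge0 ?mulr_ge0 ?ltW// divfK// gt_eqF//.
by rewrite !mulr_gt0.
Qed.

Let first_term : Num.sqrt (Delta / (L * t)) = h / Num.sqrt t.
Proof.
by rewrite invfM mulrA sqrtrM ?divr_ge0 ?ltW// sqrtrV// ltW.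
Qed.

Let ler_sqr_ge0 (a b : R) : 0 <= a -> a <= b -> a ^+ 2 <= b ^+ 2.
Proof. by move=> a0 ab; rewrite !expr2 ler_pM. Qed.

Let le_sqr_le (a b : R) : 0 <= b -> a ^+ 2 <= b ^+ 2 -> a <= b.
Proof. by move=> b0; have [//|ba] := leP a b; nra. Qed.

Lemma stepsize_gt0 : 0 < gamma.
Proof.
rewrite mulr_gt0// !lt_min first_term.
by rewrite w0 !(divr_gt0, mulr_gt0)// sqrtr_gt0.
Qed.

Let gamma_ge0 : 0 <= gamma. Proof. exact/ltW/stepsize_gt0. Qed.

Let gamma_le : [/\ gamma <= c * (h / Num.sqrt t), gamma <= c * (alpha * h),
  gamma <= c * (h / (alpha * t * ell)),
  gamma <= c * (Delta / (sigma * Q * t * ell)) & gamma <= c * w].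
Proof.
rewrite -first_term; split; rewrite ler_pM2l// ?ge_min ?lexx ?orbT//.
Qed.

(* With [lambda = max (4 sqrt (L Delta)) (sigma / A)] and
   [lambda_h = 2 gamma (L + sigma_h) / A]. *)
Lemma stepsize_budget : c <= 10000^-1 ->
  2 * gamma * (t * ((alpha * (Num.max (4 * Num.sqrt (L * Delta)) (sigma / A) / 2)
    + 2 * gamma * (L + sigma_h) / A / 2) * (16 * (ell + 65)))
    + 2 * Num.sqrt (L * Delta) / alpha)
  + t * (L / 2 * gamma ^+ 2) <= Delta.
Proof.
move=> c1; have [g1 g2 g3 g4 g5] := gamma_le.
have g0 := stepsize_gt0.
rewrite sqrtLD.
(* Each of the five terms of the minimum pays for one term of the budget: the curvature, the initial
   error, the two branches of the gradient clipping level, the Hessian clipping level. *)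
have b1 : gamma ^+ 2 * (t * L) <= c ^+ 2 * Delta.
  have := ler_sqr_ge0 gamma_ge0 g1.
  move=> /(ler_wpM2r (ltW (mulr_gt0 t0 L0))) /le_trans; apply.
  rewrite !exprMn exprVn (sqr_sqrtr (ltW t0)) -/h le_eqVlt; apply/orP; left.
  apply/eqP; rewrite -[in RHS]hE; move: (h) => h'.
  by field; rewrite gt_eqF.
have b2 : gamma * (L * h / alpha) <= c * Delta.
  move: g2 => /(ler_wpM2r (ltW (divr_gt0 (mulr_gt0 L0 h0) alpha0))) /le_trans.
  apply; rewrite -hE le_eqVlt; apply/orP; left.
  by apply/eqP; field; rewrite gt_eqF.
have b3 : gamma * (ell * t * alpha * (L * h)) <= c * Delta.
  have p0 : 0 <= ell * t * alpha * (L * h) by rewrite !mulr_ge0 ?ltW.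
  move: g3 => /(ler_wpM2r p0) /le_trans; apply.
  rewrite -hE le_eqVlt; apply/orP; left.
  by apply/eqP; field; rewrite !gt_eqF.
have b4 : gamma * (ell * t * (sigma * Q)) <= c * Delta.
  have p0 : 0 <= ell * t * (sigma * Q) by rewrite !mulr_ge0 ?ltW.
  move: g4 => /(ler_wpM2r p0) /le_trans; apply.
  rewrite le_eqVlt; apply/orP; left.
  by apply/eqP; field; rewrite !gt_eqF.
have b5 : gamma ^+ 2 * (ell * t * (L + sigma_h) / A) <= c ^+ 2 * Delta.
  have := ler_sqr_ge0 gamma_ge0 g5.
  have p0 : 0 <= ell * t * (L + sigma_h) / A by rewrite divr_ge0 ?mulr_ge0 ?ltW.
  move=> /(ler_wpM2r p0) /le_trans; apply.
  rewrite le_eqVlt; apply/orP; left; apply/eqP.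
  transitivity (c ^+ 2 * (w ^+ 2 * ((L + sigma_h) * t * ell)) / A); first by ring.
  by rewrite wE mulrA mulfK// gt_eqF.
have AalE : A = alpha * tau.
  apply: (mulIf (lt0r_neq0 t0)).
  by rewrite AE mulrAC alphaE expr2.
(* [alpha] times the branch [sigma / A] of the clipping level is [sigma * Q], the quantity in the
   fourth stepsize term. *)
have alAQ : alpha / A = Q.
  rewrite AalE invfM mulrA divff ?gt_eqF// mul1r.
  by rewrite -[RHS](mulfK (lt0r_neq0 tau0)) QE mul1r.
set lam := Num.max _ _.
have lamP : alpha * lam <= 4 * alpha * (L * h) + sigma * Q.
  have x0 : 0 <= 4 * (L * h) by rewrite !mulr_ge0 ?ltW.
  have y0 : 0 <= sigma / A by rewrite divr_ge0 ?ltW.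
  have : lam <= 4 * (L * h) + sigma / A.
    by rewrite /lam ge_max lerDl lerDr x0 y0.
  move=> /(ler_wpM2l (ltW alpha0)) /le_trans; apply.
  by rewrite -alAQ le_eqVlt; apply/orP; left; apply/eqP; ring.
(* As [ell] is at least 1, [ell + 65] is at most 66 times [ell], and 16 times 66 is 1056. *)
have ell65 : 16 * (ell + 65) <= 1056 * ell by have := ell1; lra.
have lam0 : 0 <= alpha * lam.
  rewrite mulr_ge0 ?(ltW alpha0)// /lam le_max; apply/orP; left.
  by rewrite !mulr_ge0// ltW.
set H := gamma * (L + sigma_h) / A.
have H0 : 0 <= H by apply/ltW; rewrite /H divr_gt0// mulr_gt0.
have s1 : alpha * (lam / 2) + 2 * gamma * (L + sigma_h) / A / 2 =
   alpha * lam / 2 + H by rewrite /H; field; rewrite gt_eqF.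
rewrite s1.
have s2 : gamma * (t * ((alpha * lam / 2 + H) * (16 * (ell + 65)))) <=
    528 * (gamma * (ell * t) * (4 * alpha * (L * h) + sigma * Q))
    + 1056 * (gamma ^+ 2 * (ell * t * (L + sigma_h) / A)).
  have u0 : 0 <= alpha * lam / 2 + H by lra.
  apply: (@le_trans _ _ (gamma * (t * ((alpha * lam / 2 + H) * (1056 * ell))))).
    by rewrite ler_pM2l// ler_pM2l// ler_wpM2l.
  have v0 : 0 <= gamma * (ell * t) by apply/ltW; rewrite mulr_gt0// mulr_gt0.
  have := ler_wpM2l v0 lamP.
  have -> : gamma ^+ 2 * (ell * t * (L + sigma_h) / A) = gamma * (ell * t) * H.
    by rewrite /H; ring.
  lra.
have s3 : gamma * (ell * t) * (4 * alpha * (L * h) + sigma * Q) =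
  4 * (gamma * (ell * t * alpha * (L * h))) + gamma * (ell * t * (sigma * Q)).
  by ring.
rewrite s3 in s2.
have s4 : 2 * gamma * (t * ((alpha * lam / 2 + H) * (16 * (ell + 65)))
    + 2 * (L * h) / alpha) + t * (L / 2 * gamma ^+ 2) =
  2 * (gamma * (t * ((alpha * lam / 2 + H) * (16 * (ell + 65)))))
  + 4 * (gamma * (L * h / alpha)) + gamma ^+ 2 * (t * L) / 2.
  by field; rewrite gt_eqF.
rewrite s4.
(* The terms add up to 5284 c + 2112.5 c^2 times [Delta], about half of [Delta] at c = 1/10000. *)
have c2 : c ^+ 2 <= c * 10000^-1 by rewrite expr2 ler_pM2l.
have := Delta0; have := ler_wpM2r (ltW Delta0) c2; have := ler_wpM2r (ltW Delta0) c1.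
move: s2 b1 b2 b3 b4 b5.
move: (gamma * (t * _)) (gamma * (L * h / alpha)) (gamma ^+ 2 * (t * L)).
move: (gamma * (ell * t * alpha * (L * h))) (gamma * (ell * t * (sigma * Q))).
move: (gamma ^+ 2 * _) => z1 z2 z3 z4 z5 z6.
lra.
Qed.

(** Checked on each term of the minimum. In powers of [t], the second, fourth and fifth terms give
    exactly the rate [tau]; the first and the third keep slack from [tau ^+ 2 <= t]. *)
Lemma stepsize_rate eps :
  4 * (Num.sqrt (Delta * (L + sigma_h)) + sigma) * ell <= c * eps * tau ->
  4 * Delta <= gamma * t * eps.
Proof.
set b := Num.sqrt _; move=> rate.
have b0 : 0 < b by rewrite sqrtr_gt0 mulr_gt0.
have bE : b ^+ 2 = Delta * (L + sigma_h) by rewrite sqr_sqrtr ?mulr_ge0 ?ltW.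
set e := c * eps.
have e0 : 0 < e.
  rewrite -(pmulr_lgt0 _ tau0); apply: lt_le_trans rate.
  by rewrite !mulr_gt0// addr_gt0.
have eps0 : 0 < eps by rewrite -(pmulr_rgt0 _ c0).
have st0 : 0 < Num.sqrt t by rewrite sqrtr_gt0.
have Lhb : L * h <= b.
  apply: le_sqr_le; first exact: ltW.
  by rewrite bE exprMn; have := hE; have := mulr_gt0 Delta0 sigma_h0; nra.
have tst : tau <= Num.sqrt t.
  by apply: le_sqr_le; [exact: ltW|rewrite (sqr_sqrtr (ltW t0))].
have hrate : 4 * Delta * ell <= h * (e * tau).
  rewrite -hE; have := ler_wpM2l (ltW h0) rate; rewrite -/e.
  have p1 := ler_wpM2l (ltW (mulr_gt0 h0 ell0)) Lhb.
  have p2 := mulr_gt0 (mulr_gt0 h0 ell0) sigma0.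
  lra.
have hrate1 : 4 * Delta <= h * (e * tau).
  by apply: le_trans hrate; rewrite ler_peMr// mulr_ge0 ?ltW.
have -> : gamma * t * eps = e * t * (gamma / c).
  by rewrite /e; field; rewrite gt_eqF.
rewrite [leRHS]mulrC -ler_pdivrMr ?mulr_gt0//.
rewrite [leRHS]mulrC /gamma mulKf ?gt_eqF// !le_min first_term.
rewrite !ler_pdivrMr ?mulr_gt0//.
apply/and5P; split.
- apply: (le_trans hrate1).
  rewrite (_ : h / Num.sqrt t * (e * t) = h * (e * Num.sqrt t)); last first.
    transitivity (h / Num.sqrt t * (e * (Num.sqrt t * Num.sqrt t))).
      by rewrite -expr2 sqr_sqrtr ?ltW.
    by field; rewrite gt_eqF.
  by rewrite ler_pM2l// ler_pM2l.
- apply: (le_trans hrate1).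
  by rewrite -alphaE le_eqVlt; apply/orP; left; apply/eqP; ring.
- rewrite (_ : h / _ * (e * t) = h * e / (alpha * ell)); last first.
    by field; rewrite !gt_eqF.
  rewrite ler_pdivlMr ?mulr_gt0// mulrCA mulrC.
  have ta : tau * alpha <= 1.
    by rewrite -(ler_pM2r t0) -mulrA alphaE mul1r -expr2.
  have := ler_wpM2r (ltW alpha0) hrate.
  have := ler_wpM2l (ltW (mulr_gt0 h0 e0)) ta; lra.
- rewrite (_ : Delta / _ * (e * t) = Delta * (e / (sigma * Q * ell))); last first.
    by field; rewrite !gt_eqF.
  rewrite mulrC ler_pM2l// ler_pdivlMr ?mulr_gt0//.
  have := ler_wpM2r (ltW Q0) rate; rewrite -/e.
  have -> : e * tau * Q = e by rewrite -mulrA [tau * Q]mulrC QE mulr1.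
  have := mulr_gt0 (mulr_gt0 b0 ell0) Q0; lra.
- apply: le_sqr_le.
    by apply/ltW; rewrite mulr_gt0// mulr_gt0.
  have E1 : (w * (e * t)) ^+ 2 * ((L + sigma_h) * ell) = Delta * (e * tau) ^+ 2.
    transitivity (w ^+ 2 * ((L + sigma_h) * t * ell) * (e ^+ 2 * t)); first by ring.
    by rewrite wE [(e * tau) ^+ 2]exprMn -AE; ring.
  rewrite -(ler_pM2r (mulr_gt0 Lsh0 ell0)) E1.
  have h1 : 4 * b * ell <= e * tau.
    by apply: le_trans rate; have := mulr_gt0 sigma0 ell0; lra.
  have h2 : (4 * b * ell) ^+ 2 <= (e * tau) ^+ 2.
    by apply: ler_sqr_ge0 => //; rewrite !mulr_ge0 ?ltW.
  apply: (le_trans _ (ler_wpM2l (ltW Delta0) h2)).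
  rewrite !exprMn bE.
  have := ler_wpM2l (ltW (mulr_gt0 (mulr_gt0 (mulr_gt0 Delta0 Delta0) Lsh0) ell0)) ell1.
  lra.
Qed.

End stepsize_bounds.

(** * Powers of T attached to the momentum *)

Section momentum_powers.
Context {R : realType}.
Variables (p : R) (T : nat).
Hypothesis p12 : 1 < p <= 2.
Hypothesis T0 : (0 < T)%N.

Let t : R := T%:R.
Let al : R := momentum p T.
Let tau : R := t `^ ((p - 1) / (2 * p - 1)).

Let p1 : 1 < p. Proof. by case/andP: p12. Qed.
Let t1 : 1 <= t. Proof. by rewrite ler1n. Qed.
Let t0 : 0 < t. Proof. exact: lt_le_trans ltr01 t1. Qed.
Let pn0 : p != 0. Proof. by rewrite gt_eqF// (lt_trans ltr01). Qed.
Let qn0 : 2 * p - 1 != 0. Proof. by rewrite gt_eqF//; have := p1; lra. Qed.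

Let powRDt (a b : R) : t `^ a * t `^ b = t `^ (a + b).
Proof. by rewrite powRD// (gt_eqF t0) implybT. Qed.

Lemma momentum_gt0 : 0 < al. Proof. exact: powR_gt0. Qed.

Lemma momentum_le1 : al <= 1.
Proof.
rewrite -(powRr0 t) ler_powR// oppr_le0 divr_ge0//; have := p1; lra.
Qed.

Lemma momentum_mul : al * t = tau.
Proof.
rewrite -{1}(powRr1 (ltW t0)) /al /momentum -/t powRDt; congr (_ `^ _).
by field; rewrite qn0.
Qed.

Lemma momentum_root_mul : al `^ p^-1 * t = tau ^+ 2.
Proof.
rewrite -{1}(powRr1 (ltW t0)) /al /momentum -/t -powRrM powRDt -powR_mulrn ?powR_ge0//.
by rewrite -powRrM; congr (_ `^ _); field; rewrite pn0 qn0.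
Qed.

Lemma momentum_coroot_mul : al `^ ((p - 1) / p) * tau = 1.
Proof.
rewrite /al /momentum -/t -powRrM powRDt -[RHS](powRr0 t); congr (_ `^ _).
by field; rewrite pn0 qn0.
Qed.

Lemma momentum_rootK : (al `^ p^-1) `^ p = al.
Proof. by rewrite -powRrM mulVf// powRr1// ltW// momentum_gt0. Qed.

Lemma powR_rate_ge1 : 1 <= tau.
Proof.
rewrite -(powRr0 t) ler_powR// divr_ge0//; have := p1; lra.
Qed.

Lemma powR_rate_sqr : tau ^+ 2 <= t.
Proof.
rewrite -powR_mulrn ?powR_ge0// /tau -powRrM -[leRHS](powRr1 (ltW t0)) ler_powR//.
rewrite mulrAC ler_pdivrMr; have := p1; lra.
Qed.

End momentum_powers.

(** * Number of iterations that reaches the accuracy *)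

Section iteration_threshold.
Context {R : realType}.

Lemma ln_le_sqrt (y : R) : 0 < y -> ln y <= 2 * Num.sqrt y.
Proof.
move=> y0; have s0 : 0 < Num.sqrt y by rewrite sqrtr_gt0.
rewrite -{1}(sqr_sqrtr (ltW y0)) lnXn// mulr2n.
by have := ln_sublinear s0; lra.
Qed.

(** [T] occurs on both sides, through its logarithm on the left. The slack [y = tau / B] over the
    target [B] beats it, since [ln y] is at most twice the square root of [y]. [C] comes before [S]
    and [eps0] after it: [ln S] is absorbed by taking [eps] small, without entering [C]. *)
Lemma iteration_threshold (p c : R) : 1 < p <= 2 -> 0 < c <= 1 ->
  exists2 C : R, 0 < C & forall S : R, 0 < S ->
  exists2 eps0 : R, 0 < eps0 & forall delta eps : R,
    0 < delta <= 1 -> 0 < eps < eps0 ->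
  exists2 T0 : nat, (oracle_calls T0)%:R <=
      C * (S / eps * ln (1 / (delta * eps))) `^ ((2 * p - 1) / (p - 1)) &
    forall T : nat, (T0 <= T)%N ->
      [/\ (1 < T)%N, 1 <= ln (T%:R / delta) &
        4 * S * ln (T%:R / delta)
          <= c * eps * T%:R `^ ((p - 1) / (2 * p - 1))].
Proof.
move=> /andP[p1 p2] /andP[c0 c1].
set rho := (p - 1) / (2 * p - 1).
have rho0 : 0 < rho by rewrite divr_gt0; lra.
have rho1 : rho <= 1 by rewrite ler_pdivrMr; lra.
have -> : (2 * p - 1) / (p - 1) = rho^-1 by rewrite /rho invf_div.
clearbody rho.
pose kappa := c / 4; have k0 : 0 < kappa by rewrite divr_gt0.
pose C0 := 6 / (rho * kappa).
have C00 : 0 < C0 by rewrite divr_gt0// mulr_gt0.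
have C01 : 1 <= C0.
  rewrite /C0 ler_pdivlMr ?mulr_gt0// mul1r; have : kappa <= 1 by rewrite /kappa; lra.
  have := ltW k0; nra.
pose C1 := C0 ^+ 2; have C10 : 0 < C1 by rewrite exprn_gt0.
have C11 : 1 <= C1 by rewrite exprn_ege1.
exists (2 * C1 `^ rho^-1); first by rewrite mulr_gt0// powR_gt0.
move=> S S0.
have e0 : 0 < expR 1 :> R := expR_gt0 1.
(* Below [S^-1], [ln S] is at most [- ln eps]; below [S / expR 1], [S / eps] is at least [expR 1];
   below [(expR 1)^-1], the logarithm [l0] is at least 1. *)
exists (Num.min S^-1 (Num.min (S / expR 1) (expR 1)^-1)).
  by rewrite !lt_min !invr_gt0 divr_gt0// S0 e0.
move=> delta eps /andP[d0 d1] /andP[ep0]; rewrite !lt_min => /and3P[ep1 ep2 ep3].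
pose l0 := ln (1 / (delta * eps)).
have de0 : 0 < delta * eps by rewrite mulr_gt0.
have dee : delta * eps <= eps by rewrite ler_piMl// ltW.
have l01 : 1 <= l0.
  rewrite -(expRK 1) ler_ln ?posrE ?divr_gt0// ler_pdivlMr//.
  rewrite -ler_pdivlMl// mulr1; apply: (le_trans dee); exact: ltW.
have l00 : 0 < l0 by exact: lt_le_trans l01.
pose B := S / eps * l0.
have B0 : 0 < B by rewrite mulr_gt0// divr_gt0.
have BS : expR 1 <= B.
  apply: (@le_trans _ _ (S / eps)); last by rewrite ler_peMr// divr_ge0 ?ltW.
  by rewrite ler_pdivlMr// mulrC -ler_pdivlMr// ltW.
pose X := (C1 * B) `^ rho^-1.
(* A run with parameter [T0] has [T0.-1] iterations, so rounding up still leaves only twice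
   [Num.trunc X] calls. *)
exists (Num.trunc X).+1.
  rewrite /oracle_calls /= natrM -/l0 -/B -mulrA.
  rewrite -(powRM _ (ltW C10) (ltW B0)) -/X.
  by rewrite ler_pM2l// truncn_le ?powR_ge0.
move=> T TX.
have tX : X <= T%:R.
  apply: (@le_trans _ _ (Num.trunc X).+1%:R); last by rewrite ler_nat.
  exact/ltW/truncnS_gt.
set t := T%:R in tX *; set tau := t `^ rho.
have C1B : C1 * B <= tau.
  have -> : C1 * B = X `^ rho.
    by rewrite -powRrM mulVf ?gt_eqF// powRr1// ltW// mulr_gt0.
  by rewrite ge0_ler_powR ?nnegrE ?powR_ge0 ?(ltW rho0)// ler0n.
have tau_e : expR 1 <= tau.
  apply: le_trans C1B; apply: (le_trans BS).
  by rewrite ler_peMl// ltW.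
have e1 : 1 < expR 1 :> R by rewrite expR_gt1.
have t1 : 1 <= t.
  rewrite ler1n lt0n; apply/eqP => T0; move: tau_e.
  by rewrite /tau /t T0 powR0 ?gt_eqF//; lra.
have t0 : 0 < t by exact: lt_le_trans t1.
have te : expR 1 <= t by apply: (le_trans tau_e); exact: ler1_powR.
have T1 : (1 < T)%N by rewrite -(ltr_nat R) (lt_le_trans e1).
have lnd : ln (t / delta) = ln t - ln delta by rewrite ln_div.
have lnd0 : ln delta <= 0 by rewrite ln_le0.
have l0E : l0 = - ln delta - ln eps.
  by rewrite /l0 div1r lnV ?posrE// lnM ?posrE// opprD.
have lneps : ln eps <= 0.
  rewrite ln_le0//; apply: (le_trans (ltW ep3)).
  by rewrite invf_le1// ltW.
split => //.
  rewrite lnd; have : 1 <= ln t by rewrite -(expRK 1) ler_ln ?posrE.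
  by move: lnd0; lra.
pose y := tau / B.
have yC1 : C1 <= y by rewrite ler_pdivlMr.
have y0 : 0 < y by exact: lt_le_trans yC1.
have sy : C0 <= Num.sqrt y.
  by rewrite (_ : C0 = Num.sqrt C1) ?ler_wsqrtr// sqrtr_sqr gtr0_norm.
have tauE : tau = y * B by rewrite /y divfK// gt_eqF.
have lnt : rho * ln t = ln y + (ln S - ln eps + ln l0).
  rewrite -ln_powR -/tau tauE lnM ?posrE// /B lnM ?posrE ?divr_gt0//.
  by rewrite ln_div ?posrE.
have lnS : ln S <= - ln eps.
  rewrite -lnV ?posrE// ler_ln ?posrE ?invr_gt0//.
  by rewrite -[S]invrK lef_pV2 ?posrE ?invr_gt0// ltW.
have lnl0 := ln_sublinear l00.
have lny := ln_le_sqrt y0.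
set sq := Num.sqrt y in sy lny.
have sq2 : sq ^+ 2 = y by rewrite sqr_sqrtr// ltW.
(* The left side is at most [2 * sq + 3 * l0]: [ln y] is at most [2 * sq], the logarithms of [eps]
   and [delta] contribute at most [2 * l0], and [ln l0] at most [l0]. Since [sq] and [l0] are at
   least 1, the product dominates; its constant 6 is the one in [C0]. *)
have b1 : rho * ln (t / delta) <= 6 * sq * l0.
  rewrite lnd mulrBr lnt.
  have : rho * - ln delta <= - ln delta by rewrite ler_piMl// oppr_ge0.
  have : 1 <= sq by exact: le_trans sy.
  by move=> q1 q2; nra.
have b2 : 6 * sq <= rho * (kappa * y).
  rewrite -sq2; have := ler_wpM2l (ltW (mulr_gt0 rho0 k0)) sy.
  rewrite /C0 mulrCA divff ?mulr1 ?gt_eqF ?mulr_gt0//.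
  have sq0 : 0 <= sq by exact: sqrtr_ge0.
  by move=> /(ler_wpM2r sq0); rewrite expr2; lra.
have b3 : ln (t / delta) <= kappa * y * l0.
  rewrite -(ler_pM2l rho0); apply: (le_trans b1).
  by rewrite mulrA ler_wpM2r// ltW.
have -> : c * eps * tau = 4 * S * (kappa * y * l0).
  by rewrite tauE /B /kappa; field; rewrite gt_eqF.
by rewrite ler_pM2l// mulr_gt0.
Qed.

End iteration_threshold.

(** * Assembling the guarantee *)

Lemma nsgd_zero_stepsize {R : realType} {d : nat} {Xi : Type}
    (gradf : 'rV[R]_d -> Xi -> 'rV[R]_d) (hessf : 'rV[R]_d -> Xi -> 'M[R]_d)
    (alpha lambda lambda_h : R) (x0 : 'rV[R]_d)
    (q : nat -> R) (xi xih : nat -> Xi) (t : nat) :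
  nsgd_iterate gradf hessf 0 alpha lambda lambda_h x0 q xi xih t = x0.
Proof.
suff : (nsgd_state gradf hessf 0 alpha lambda lambda_h x0 q xi xih t).1 = (x0, x0).
  by rewrite /nsgd_iterate => ->.
elim: t => [//|t /=]; case: nsgd_state => [[a b] g] /= [-> ->].
by rewrite scale0r subr0.
Qed.

Lemma high_probability_bound {R : realType} {d : nat}
    {dO dXi : measure_display} {Omega : measurableType dO}
    {Xi : measurableType dXi} (P : probability Omega R) (D : probability Xi R)
    (p L sigma sigma_h Fstar : R) (F : 'rV[R]_d -> R)
    (gradf : 'rV[R]_d -> Xi -> 'rV[R]_d) (hessf : 'rV[R]_d -> Xi -> 'M[R]_d)
    (x0 : 'rV[R]_d) (q : nat -> {RV P >-> R}) (xi xih : nat -> {RV P >-> Xi})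
    (T : nat) (gamma alpha lg lh delta eps : R) :
  let Delta := F x0 - Fstar in
  1 <= p <= 2 -> 0 < L -> 0 < sigma_h -> smooth L F ->
  (forall y, differentiable (grad F) y) -> (forall y, Fstar <= F y) ->
  bcm_gradient D p sigma F gradf -> bcm_hessian D p sigma_h F hessf ->
  nsgd_samples D q xi xih T -> (1 < T)%N -> 0 < delta ->
  0 <= ln (T%:R / delta) -> 0 < gamma -> 0 < alpha <= 1 -> 0 < lg -> 0 < lh ->
  sigma `^ p <= 16 * alpha * lg `^ p ->
  (gamma * (L + sigma_h)) `^ p <= alpha * lh `^ p -> L * gamma <= lh ->
  2 * Num.sqrt (L * Delta) <= lg ->
  2 * gamma * (T%:R * ((alpha * lg + lh) * (16 * (ln (T%:R / delta) + 65)))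
    + 2 * Num.sqrt (L * Delta) / alpha) + T%:R * (L / 2 * gamma ^+ 2)
    <= Delta ->
  4 * Delta <= gamma * T%:R * eps ->
  ((1 - delta)%:E <= P [set w | (T%:R^-1 * \sum_(t < T) enorm (grad F
     (nsgd_iterate gradf hessf gamma alpha (2 * lg) (2 * lh) x0
       (fun s => q s w) (fun s => xi s w) (fun s => xih s w) t)) <= eps)%R])%E.
Proof.
move=> Delta p12 L0 sh0 smoothF dgF lbF bcmg bcmh samples T1 d0 ell0 gamma0 al01
  lg0 lh0 lgP lhP lhL lgD budget gap.
have al0 : 0 < alpha by case/andP: al01.
set ell := ln _ in ell0 budget.
have t0 : 0 < T%:R :> R by rewrite ltr0n (ltn_trans _ T1).
(* With this radius the failure bound [T.-1%:R * (expR 65 * expR (- (r / 16)))] equals [delta] times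
   (T - 1) / T. *)
set r := 16 * (ell + 65) in budget.
have r0 : 0 <= r by rewrite /r; lra.
have s0 : 0 < alpha * lg + lh by rewrite addr_gt0// mulr_gt0.
have error_le w t : good F gradf hessf x0 q xi xih gamma alpha lg lh r w t = 1 ->
    forall i, (i <= t)%N -> enorm (scaled_error F gradf hessf x0 q xi xih
      gamma alpha lg lh w i) <= r.
  move=> gw; have := goodP F gradf hessf x0 q xi xih gamma alpha lg lh r0 w t.
  case=> [g0|[_ //]].
  by move: gw; rewrite g0 => /eqP; rewrite eq_sym oner_eq0.
(* Closes the loop between the two halves: the error bounds up to [t] give, by descent, the gradient
   bound that the concentration argument assumes at the next point. *)
have grad_lg w t : (t.+1 < T)%N ->
    good F gradf hessf x0 q xi xih gamma alpha lg lh r w t = 1 ->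
    enorm (grad F (run gradf hessf x0 q xi xih gamma alpha lg lh w t).1.2) <= lg.
  move=> tT /error_le gw; apply: le_trans lgD.
  exact: (run_grad_le L0 smoothF lbF (ltW gamma0) al01 s0 r0 budget
    (ltnW tT) gw).
have TT : (T.-1 < T)%N by rewrite prednK// (ltn_trans _ T1).
have mgrad t : measurable_fun setT (fun w => enorm (grad F
    (run gradf hessf x0 q xi xih gamma alpha lg lh w t).1.1)).
  exact: (measurable_grad_run x0 q xi xih gamma alpha lg lh dgF bcmg bcmh t).
set Good := [set w | _].
have mGood : measurable Good.
  have mavg : measurable_fun setT (fun w => T%:R^-1 * \sum_(t < T) enorm (grad F
      (run gradf hessf x0 q xi xih gamma alpha lg lh w t).1.1)).
    by apply: measurable_funM => //; apply: measurable_sum => t.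
  have -> : Good = setT `&` (fun w => T%:R^-1 * \sum_(t < T) enorm (grad F
      (run gradf hessf x0 q xi xih gamma alpha lg lh w t).1.1)) @^-1`
      `]-oo, eps].
    by apply/seteqP; split => w; rewrite /Good /= in_itv/=; [|case].
  exact: mavg.
have h := good_probability p12 L0 sh0 smoothF dgF bcmg bcmh samples
  (ltW gamma0) al01 lg0 lh0 r0 lgP lhP lhL grad_lg TT mGood.
apply: le_trans (h _).
  rewrite lee_fin lerD2l lerN2.
  have -> : r / 16 = ell + 65 by rewrite /r mulrC mulKf.
  rewrite -expRD.
  have -> : 65 + - (ell + 65) = - ell by ring.
  rewrite expRN lnK ?posrE ?divr_gt0// invf_div mulrA.
  by rewrite ler_pdivrMr// mulrC ler_pM2l// ler_nat leq_pred.
(* On the good event [gamma] times the sum of gradient norms is at most [4 * Delta], which [gap]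
   compares with [eps]. *)
move=> w gw; rewrite /Good /= mulrC ler_pdivrMr//.
rewrite -(ler_pM2l gamma0) mulrCA mulrA -[leRHS]mulrA [leRHS]mulrC.
have sumle := run_grad_sum L0 smoothF lbF (ltW gamma0) al01 s0 r0 budget T1.
apply: (le_trans _ gap); apply: sumle => i iT.
by apply: (error_le _ _ gw); rewrite -ltnS prednK// (ltn_trans _ T1).
Qed.

(** The order of the quantifiers encodes the asymptotic notation: [c] is universal, [C] sees only
    [p], and [eps0] also the problem parameters. [T0] carries the cost, and it is chosen before the
    objective, the oracles and the dimension. *)
Theorem corollary1 (R : realType) :
  exists2 c : R, 0 < c &
  forall p : R, 1 < p <= 2 ->
  exists2 C : R, 0 < C &
  forall L sigma sigma_h Delta1 : R, 0 < L -> 0 < sigma -> 0 < sigma_h ->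
  exists2 eps0 : R, 0 < eps0 &
  forall delta eps : R, 0 < delta <= 1 -> 0 < eps < eps0 ->
  exists2 T0 : nat,
    (oracle_calls T0)%:R <= C * complexity p L sigma sigma_h Delta1 delta eps &
  forall T : nat, (0 < T)%N -> 1 <= ln (8 * T%:R / delta) -> (T0 <= T)%N ->
  forall (d : nat) (dXi : measure_display) (Xi : measurableType dXi)
    (D : probability Xi R)
    (f : 'rV[R]_d -> Xi -> R) (F : 'rV[R]_d -> R) (Fstar : R)
    (gradf : 'rV[R]_d -> Xi -> 'rV[R]_d) (hessf : 'rV[R]_d -> Xi -> 'M[R]_d)
    (x0 : 'rV[R]_d),
  stochastic_objective D f F ->
  (forall x, Fstar <= F x) ->
  smooth L F ->
  twice_differentiable F ->
  bcm_gradient D p sigma F gradf ->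
  bcm_hessian D p sigma_h F hessf ->
  Delta1 = F x0 - Fstar ->
  forall (dO : measure_display) (Omega : measurableType dO)
    (P : probability Omega R)
    (q : nat -> {RV P >-> R}) (xi xih : nat -> {RV P >-> Xi}),
  nsgd_samples D q xi xih T ->
  let gamma := stepsize c p L sigma sigma_h Delta1 delta T in
  let alpha := momentum p T in
  let lambda := grad_clip_level p L sigma Delta1 T in
  let lambda_h := hess_clip_level p L sigma_h gamma T in
  let x (w : Omega) (t : nat) :=
    nsgd_iterate gradf hessf gamma alpha lambda lambda_h x0
      (fun s => q s w) (fun s => xi s w) (fun s => xih s w) t in
  ((1 - delta)%R%:E <=
   P [set w | ((T%:R)^-1 * \sum_(t < T) enorm (grad F (x w t)) <= eps)%R])%E.
Proof.
(* The value 1/10000 comes from the numerical condition in [stepsize_budget]. *)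
have [c c0 c1] : exists2 c : R, 0 < c & c <= 10000^-1.
  by exists (100^-1 ^+ 2); [rewrite exprn_gt0// invr_gt0|lra].
have c01 : 0 < c <= 1 by rewrite c0 /=; lra.
exists c => // p p12.
have [C C0 HC] := iteration_threshold p12 c01.
exists C => // L sigma sigma_h Delta1 L0 sigma0 sigma_h0.
have S0 : 0 < Num.sqrt (Delta1 * (L + sigma_h)) + sigma.
  by rewrite ltr_wpDl// sqrtr_ge0.
have [eps0 eps00 Heps] := HC _ S0.
exists eps0 => // delta eps d01 e01.
have [T0 T0le HT] := Heps delta eps d01 e01.
exists T0 => // T Tgt0 _ T0T d dXi Xi D f F Fstar gradf hessf x0 _ lbF smoothF.
move=> [_ dgF] bcmg bcmh DeltaE dO Omega P q xi xih samples.
have [T1 ell1 rate] := HT T T0T.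
have /andP[d0 d1] := d01; have /andP[e0 _] := e01.
have Delta_ge0 : 0 <= Delta1 by rewrite DeltaE subr_ge0.
pose gamma := stepsize c p L sigma sigma_h Delta1 delta T.
pose alpha := momentum p T.
pose lambda := grad_clip_level p L sigma Delta1 T.
pose lambda_h := hess_clip_level p L sigma_h gamma T.
pose x w t := nsgd_iterate gradf hessf gamma alpha lambda lambda_h x0
  (fun s => q s w) (fun s => xi s w) (fun s => xih s w) t.
suff : ((1 - delta)%R%:E <=
   P [set w | ((T%:R)^-1 * \sum_(t < T) enorm (grad F (x w t)) <= eps)%R])%E.
  by [].
(* A zero gap makes the stepsize vanish, so the general estimates degenerate; but then [x0] is a
   minimizer with zero gradient, and the iterates stay there. *)
have [D0|Dpos] := eqVneq Delta1 0.
  have gamma_eq0 : gamma = 0.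
    by rewrite /gamma /stepsize D0 !mul0r sqrtr0 mulr0 !mul0r !minxx mulr0.
  have g0 : enorm (grad F x0) = 0.
    apply/eqP; rewrite eq_le enorm_ge0 andbT.
    have := @grad_le_gap _ _ F L Fstar L0 smoothF lbF x0 0 (lexx _).
    by rewrite -DeltaE D0 !mulr0 sqrtr0 mulr0; apply.
  rewrite (_ : [set w | _] = setT).
    by rewrite probability_setT lee_fin gerBl ltW.
  apply/seteqP; split => // w _ /=.
  rewrite big1 ?mulr0 ?ltW// => t _.
  by rewrite /x gamma_eq0 nsgd_zero_stepsize.
have {Dpos Delta_ge0} Delta0 : 0 < Delta1 by rewrite lt_def Dpos.
have t0 : 0 < T%:R :> R by rewrite ltr0n.
have al0 : 0 < alpha := momentum_gt0 p Tgt0.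
have al01 : 0 < alpha <= 1 by rewrite al0 momentum_le1.
have tau1 := powR_rate_ge1 p12 Tgt0.
have alphaE := momentum_mul p12 Tgt0.
have AE := momentum_root_mul p12 Tgt0.
have QE := momentum_coroot_mul p12 Tgt0.
have tauT := powR_rate_sqr p12 Tgt0.
have gamma0 : 0 < gamma.
  exact: (stepsize_gt0 t0 al0 tau1 ell1 Delta0 L0 sigma0 sigma_h0 c0 AE QE).
pose A := alpha `^ p^-1.
have budget : 2 * gamma * (T%:R * ((alpha *
      (Num.max (4 * Num.sqrt (L * Delta1)) (sigma / A) / 2)
    + 2 * gamma * (L + sigma_h) / A / 2) * (16 * (ln (T%:R / delta) + 65)))
    + 2 * Num.sqrt (L * Delta1) / alpha)
  + T%:R * (L / 2 * gamma ^+ 2) <= Delta1.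
  exact: (stepsize_budget t0 al0 tau1 ell1 Delta0 L0 sigma0 sigma_h0 c0
    alphaE AE QE c1).
have gap : 4 * Delta1 <= gamma * T%:R * eps.
  exact: (stepsize_rate t0 al0 tau1 ell1 Delta0 L0 sigma0 sigma_h0 c0
    alphaE AE QE tauT rate).
have /andP[p1 p2] := p12.
have p0 : 0 <= p by rewrite ltW// (lt_trans ltr01).
have p12' : 1 <= p <= 2 by rewrite (ltW p1).
have A0 : 0 < A by exact: powR_gt0.
have A1 : A <= 1.
  apply: (@le_trans _ _ (1 `^ p^-1)); last by rewrite powR1.
  rewrite /A ge0_ler_powR ?nnegrE ?invr_ge0 ?(ltW al0)//.
  exact: momentum_le1.
have ApE : A `^ p = alpha by exact: momentum_rootK p12 Tgt0.
have [lg lgE] : exists lg, lambda = 2 * lg.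
  by exists (lambda / 2); rewrite mulrC divfK.
have [lh lhE] : exists lh, lambda_h = 2 * lh.
  by exists (lambda_h / 2); rewrite mulrC divfK.
have lgE' : lg = lambda / 2 by rewrite lgE mulrC mulKf.
have lhE' : lh = lambda_h / 2 by rewrite lhE mulrC mulKf.
have lhA : A * lh = gamma * (L + sigma_h).
  rewrite lhE' /lambda_h /hess_clip_level -/alpha -/A; field.
  by rewrite gt_eqF.
have lam1 : 4 * Num.sqrt (L * Delta1) <= lambda by rewrite le_max lexx.
have lam2 : sigma / A <= lambda by rewrite le_max lexx orbT.
have lg0 : 0 < lg.
  by rewrite lgE' divr_gt0// (lt_le_trans _ lam2)// divr_gt0.
have lh0 : 0 < lh by rewrite -(pmulr_rgt0 _ A0) lhA mulr_gt0// addr_gt0.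
rewrite /x lgE lhE.
apply: (@high_probability_bound _ _ _ _ _ _ P D p L sigma sigma_h Fstar F) => //.
- exact: le_trans ell1.
(* [lg] is at least [sigma / A / 2] and the [p]-th power of [A] is [alpha], so the constant needed
   is 2^p, at most 2^4 = 16. *)
- have sE : sigma = 2 * A * (sigma / A / 2) by field; rewrite gt_eqF.
  have u0 : 0 <= sigma / A / 2 by rewrite !divr_ge0// ltW.
  have A20 : 0 <= 2 * A by rewrite mulr_ge0// ltW.
  rewrite sE powRM// powRM ?(ltW A0)// ApE.
  apply: ler_pM; rewrite ?mulr_ge0 ?powR_ge0 ?(ltW al0)//.
    rewrite ler_wpM2r ?(ltW al0)//.
    apply: (@le_trans _ _ ((2 : R) `^ 4)); first rewrite ler_powR ?ler1n//.
      by rewrite (le_trans p2)// ler_nat.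
    by rewrite (_ : (2 : R) `^ 4 = 2 ^+ 4) ?powR_mulrn// -natrX.
  by rewrite ge0_ler_powR ?nnegrE ?(ltW lg0)// lgE' ler_pM2r.
- by rewrite -lhA powRM ?(ltW A0) ?(ltW lh0)// ApE.
(* [lh] is [gamma * (L + sigma_h)] divided by [A], and [A] is at most 1. *)
- rewrite -(ler_pM2l A0) lhA mulrA [leRHS]mulrC ler_pM2r//.
  apply: (@le_trans _ _ (1 * L)); first by rewrite ler_pM2r.
  by rewrite mul1r lerDl ltW.
- rewrite -DeltaE lgE' ler_pdivlMr// mulrAC -natrM.
  exact: lam1.
- by rewrite -DeltaE lgE' lhE'; exact: budget.
- by rewrite -DeltaE; exact: gap.
Qed.
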